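(* Let $X$ be a Banach space and let $T \in L(X)$. Then the following properties are equivalent: (1) $T$ is a left semi-B-Fredholm operator, i.e. $\pi(T)$ is left Drazin invertible in $\mathcal{C}_0(X)$. (2) $T$ is a nilpotent-left semi-Fredholm operator, i.e. there exist closed $T$-invariant subspaces $M, N$ of $X$ with $X = M \oplus N$ such that $T_{\mid M}$ is nilpotent and $T_{\mid N} \in \Phi_l(N)$.
   Context: $L(X)$ is the Banach algebra of bounded linear operators on the Banach space $X$, $F_0(X)$ is the ideal of finite rank operators in $L(X)$, $\mathcal{C}_0(X) = L(X)/F_0(X)$ is the (purely algebraic) quotient algebra, and $\pi : L(X) \to \mathcal{C}_0(X)$ is the natural projection. Let $A$ be a ring with unit, and for $p \in A$ let $comm(p) = \{x \in A : xp = px\}$. For an idempotent $p \in A$, an element $a \in A$ is called left $p$-invertible if $ap = pa$ and $a + p$ is left invertible in $comm(p)$ (i.e. has a left inverse belonging to $comm(p)$). An element $a \in A$ is called left Drazin invertible if there exists an idempotent $p \in A$ such that $a$ is left $p$-invertible and $ap$ is nilpotent. For a Banach space $Y$ and $U \in L(Y)$, $N(U)$ and $R(U)$ denote the null space and range of $U$. $\Phi_l(Y)$ (the left semi-Fredholm operators on $Y$) is the set of $U \in L(Y)$ such that $R(U)$ is closed, $\dim N(U) < \infty$, and there exists a bounded projection of $Y$ onto $R(U)$. A subspace $M$ of $X$ is $T$-invariant if $T(M) \subset M$, and then $T_{\mid M} : M \to M$ is the restriction of $T$ to $M$. *)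

(* Defs.v *)
From HB Require Import structures.
From mathcomp Require Import all_boot all_order all_algebra generic_quotient.
From mathcomp Require Import complex.
From mathcomp Require Import all_classical reals topology normedtype.

Set Implicit Arguments.
Unset Strict Implicit.
Unset Printing Implicit Defensive.

Import Order.TTheory GRing.Theory Num.Theory.
Import numFieldNormedType.Exports.

Local Open Scope classical_set_scope.
Local Open Scope ring_scope.
Local Open Scope quotient_scope.

(* Banach spaces are taken over the real or the complex numbers; an arbitrary
   [numFieldType] would also allow, e.g., the rationals. *)
Variant real_or_complex : numFieldType -> Prop :=
| RealScalars (R : realType) : real_or_complex R
| ComplexScalars (R : realType) : real_or_complex R[i].

(* Rings may be trivial ([pzRingType]): L(X) / F_0(X) is the zero ring exactly
   when X is finite dimensional. *)
Section LeftDrazin.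
Variable A : pzRingType.

Definition comm (p : A) : set A := [set x | x * p = p * x].

Definition idempotent (p : A) : Prop := p * p = p.

Definition nilpotent (a : A) : Prop := exists n : nat, a ^+ n = 0.

Definition left_p_invertible (p a : A) : Prop :=
  a * p = p * a /\ exists2 b, comm p b & b * (a + p) = 1.

Definition left_Drazin_invertible (a : A) : Prop :=
  exists p : A,
    [/\ idempotent p, left_p_invertible p a & nilpotent (a * p)].

End LeftDrazin.

Section FiniteDimensional.
Variables (K : fieldType) (V : lmodType K).

Definition lin_span n (v : 'I_n -> V) : set V :=
  [set x | exists c : 'I_n -> K, x = \sum_(i < n) c i *: v i].

Definition finite_dim (S : set V) : Prop :=
  exists (n : nat) (v : 'I_n -> V), S = lin_span v.

Definition subspace_set (S : set V) : Prop :=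
  S 0 /\ forall (a : K) x y, S x -> S y -> S (a *: x + y).

Lemma subspace_sum (S : set V) n (c : 'I_n -> K) (v : 'I_n -> V) :
  subspace_set S -> (forall i, S (v i)) -> S (\sum_(i < n) c i *: v i).
Proof.
move=> [S0 SD] Sv; elim/big_ind: _ => // [x y Sx Sy|i _].
  by rewrite -(scale1r x); exact: SD.
by rewrite -[_ *: _]addr0; exact: SD.
Qed.

(* coordinates of the elements of S form a row space of some maximal rank *)
Lemma finite_dimS (S : set V) n (v : 'I_n -> V) :
  subspace_set S -> S `<=` lin_span v -> finite_dim S.
Proof.
move=> subS Sv; have [_ SD] := subS.
pose ev (r : 'rV[K]_n) : V := \sum_(i < n) r 0 i *: v i.
pose good (M : 'M[K]_n) := `[< forall i, S (ev (row i M)) >].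
have evD a r s : ev (a *: r + s) = a *: ev r + ev s.
  rewrite /ev scaler_sumr -big_split /=; apply: eq_bigr => i _.
  by rewrite !mxE scalerDl scalerA.
have ev0 : ev 0 = 0 by rewrite /ev big1// => i _; rewrite mxE scale0r.
have evsum m (c : 'I_m -> K) (r : 'I_m -> 'rV[K]_n) :
    ev (\sum_(i < m) c i *: r i) = \sum_(i < m) c i *: ev (r i).
  elim/big_rec2: _ => [//|i x y _ <-]; exact: evD.
have good0 : good 0.
  by apply/asboolP => i; rewrite row0 ev0; case: subS.
have exr : exists r, `[< exists2 M, good M & \rank M = r >].
  by exists (\rank (0 : 'M[K]_n)); apply/asboolP; exists 0.
have ubr r : `[< exists2 M, good M & \rank M = r >] -> (r <= n)%N.
  by move/asboolP => [M _ <-]; exact: rank_leq_row.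
case: (ex_maxnP exr ubr) => r /asboolP[M /asboolP gM rM] maxr.
exists n, (fun i => ev (row i M)); apply/seteqP; split => [x Sx|x [c ->]]; last first.
  exact: subspace_sum.
have [c xE] := Sv _ Sx.
pose u : 'rV[K]_n := \row_i c i.
have evu : ev u = x by rewrite xE /ev; apply: eq_bigr => i _; rewrite mxE.
suff /submxP[d ud] : (u <= M)%MS.
  exists (fun i => d 0 i); rewrite -evu ud mulmx_sum_row; exact: evsum.
rewrite -[(u <= M)%MS]negbK; apply/negP => uM.
pose W := (M + u)%MS.
have gW : good W.
  apply/asboolP => i.
  have /sub_addsmxP[[d e] /= ->] : (row i W <= M + u)%MS by exact: row_sub.
  rewrite -[d *m M]scale1r evD; apply: (SD).
    by rewrite mulmx_sum_row evsum; exact: subspace_sum.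
  rewrite [e]mx11_scalar mul_scalar_mx -[_ *: u]addr0 evD ev0 evu.
  by apply: SD => //; case: subS.
have : (\rank W <= r)%N by apply: maxr; apply/asboolP; exists W.
rewrite leqNgt => /negP; apply; rewrite -rM.
rewrite (ltn_leqif (mxrank_leqif_sup (addsmxSl M u))).
by rewrite addsmx_sub submx_refl.
Qed.

End FiniteDimensional.

Section BoundedOperators.
Variables (K : numFieldType) (X : normedModType K).

Definition bounded_op : {pred X -> X} := [pred f : X -> X | `[<
  linear f /\ exists M : K, forall x, `|f x| <= M * `|x| >]].

Record bop := Bop { bop_fun :> X -> X; bop_subproof : bop_fun \in bounded_op }.

HB.instance Definition _ := [isSub for bop_fun].
HB.instance Definition _ := [Choice of bop by <:].

Lemma bopP (f : bop) : linear f /\ exists M : K, forall x, `|f x| <= M * `|x|.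
Proof. by case: f => f /= /asboolP. Qed.

HB.instance Definition _ (f : bop) :=
  GRing.isLinear.Build K X X *:%R f (proj1 (bopP f)).

Lemma bop_ext (f g : bop) : f =1 g -> f = g.
Proof. by move=> fg; apply/val_inj/funext. Qed.

Lemma bounded_op_zmod_closed : zmod_closed bounded_op.
Proof.
split.
  apply/asboolP; split=> [a x y|].
    by rewrite -[LHS]/(0 : X) -[RHS]/(a *: (0 : X) + (0 : X)) scaler0 addr0.
  by exists 0 => x; rewrite -[X in `|X|]/(0 : X) normr0 mul0r.
move=> f g /asboolP[lf [M fM]] /asboolP[lg [N gN]]; apply/asboolP; split.
  move=> a x y; rewrite -[LHS]/(f _ - g _) -[RHS]/(a *: (f x - g x) + (f y - g y)).
  by rewrite lf lg scalerBr opprD addrACA.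
exists (M + N) => x; rewrite -[X in `|X|]/(f x - g x) mulrDl.
by rewrite (le_trans (ler_normB _ _))// lerD.
Qed.

HB.instance Definition _ :=
  GRing.isZmodClosed.Build (X -> X) bounded_op bounded_op_zmod_closed.
HB.instance Definition _ := [SubChoice_isSubZmodule of bop by <:].

Lemma bounded_op_id : idfun \in bounded_op.
Proof. by apply/asboolP; split=> //; exists 1 => x; rewrite mul1r. Qed.

Lemma bounded_op_comp (f g : bop) : f \o g \in bounded_op.
Proof.
apply/asboolP; split=> [a x y|]; first by rewrite /= !linearP.
have [_ [M fM]] := bopP f; have [_ [N gN]] := bopP g.
exists (`|M| * `|N|) => x /=; have r0 := normr_ge0.
have M1 y : `|f y| <= `|M| * `|y|.
  apply: (le_trans (fM y)); have [->|y0] := eqVneq y 0.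
    by rewrite normr0 !mulr0.
  have : 0 <= M * `|y| by exact: le_trans (fM y).
  by move=> My; rewrite -[leLHS]ger0_norm// normrM normr_id.
have N1 y : `|g y| <= `|N| * `|y|.
  apply: (le_trans (gN y)).
  have : 0 <= N * `|y| by exact: le_trans (gN y).
  by move=> Ny; rewrite -[leLHS]ger0_norm// normrM normr_id.
by rewrite (le_trans (M1 _))// -mulrA ler_wpM2l.
Qed.

Definition bop_one : bop := Bop bounded_op_id.
Definition bop_mul (f g : bop) : bop := Bop (bounded_op_comp f g).

Lemma bopD (f g : bop) x : (f + g) x = f x + g x. Proof. by []. Qed.
Lemma bopN (f : bop) x : (- f) x = - f x. Proof. by []. Qed.
Lemma bop0 x : (0 : bop) x = 0. Proof. by []. Qed.

Fact bop_mulA : associative bop_mul. Proof. by move=> *; exact: bop_ext. Qed.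
Fact bop_mul1l : left_id bop_one bop_mul.
Proof. by move=> *; exact: bop_ext. Qed.
Fact bop_mul1r : right_id bop_one bop_mul.
Proof. by move=> *; exact: bop_ext. Qed.
Fact bop_mulDl : left_distributive bop_mul +%R.
Proof. by move=> *; exact: bop_ext. Qed.
Fact bop_mulDr : right_distributive bop_mul +%R.
Proof. by move=> f g h; apply: bop_ext => x /=; rewrite linearD. Qed.

HB.instance Definition _ := GRing.Zmodule_isPzRing.Build bop
  bop_mulA bop_mul1l bop_mul1r bop_mulDl bop_mulDr.

Lemma bopM (f g : bop) x : (f * g) x = f (g x). Proof. by []. Qed.
Lemma bop1 x : (1 : bop) x = x. Proof. by []. Qed.

Definition kernel (f : bop) : set X := [set x | f x = 0].

Definition finite_rank : {pred bop} := [pred f : bop | `[< finite_dim (range f) >]].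

Lemma range_subspace (f : bop) : subspace_set (range f).
Proof.
split; first by exists 0 => //; rewrite linear0.
by move=> a _ _ [x _ <-] [y _ <-]; exists (a *: x + y) => //; rewrite linearP.
Qed.

Lemma finite_rankS (f : bop) n (v : 'I_n -> X) :
  range f `<=` lin_span v -> f \in finite_rank.
Proof. by move=> fv; apply/asboolP/(finite_dimS (range_subspace f) fv). Qed.

Lemma finite_rank_zmod_closed : zmod_closed finite_rank.
Proof.
split.
  apply: (@finite_rankS _ 0 (fun=> 0)) => _ [x _ <-].
  by exists (fun=> 0); rewrite big_ord0.
move=> f g /asboolP[n [v fv]] /asboolP[m [w gw]].
pose u (i : 'I_(n + m)) := match fintype.split i with inl j => v j | inr k => w k end.
apply: (@finite_rankS _ _ u) => _ [x _ <-].
have [c fx] : lin_span v (f x) by rewrite -fv; exists x.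
have [d gx] : lin_span w (g x) by rewrite -gw; exists x.
exists (fun i => match fintype.split i with inl j => c j | inr k => - d k end).
rewrite big_split_ord /= -[LHS]/(f x - g x) fx gx -sumrN; congr (_ + _).
  by apply: eq_bigr => i _; rewrite /u (unsplitK (inl i)).
by apply: eq_bigr => i _; rewrite /u (unsplitK (inr i)) scaleNr.
Qed.

HB.instance Definition _ :=
  GRing.isZmodClosed.Build bop finite_rank finite_rank_zmod_closed.

Lemma finite_rankMl (f g : bop) : g \in finite_rank -> f * g \in finite_rank.
Proof.
move=> /asboolP[n [v gv]]; apply: (@finite_rankS _ _ (f \o v)) => _ [x _ <-].
have [c gx] : lin_span v (g x) by rewrite -gv; exists x.
exists c; rewrite bopM gx linear_sum; apply: eq_bigr => i _.
by rewrite linearZ.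
Qed.

Lemma finite_rankMr (f g : bop) : f \in finite_rank -> f * g \in finite_rank.
Proof.
move=> /asboolP[n [v fv]]; apply: (@finite_rankS _ _ v) => _ [x _ <-].
by rewrite -fv; exists (g x).
Qed.

Definition eqF0 (f g : bop) : bool := f - g \in finite_rank.

Fact eqF0_equiv : equiv_class_of eqF0.
Proof.
split=> [f|f g|g f h]; rewrite /eqF0.
- by rewrite subrr rpred0.
- by rewrite -rpredN opprB.
- by move=> fg gh; rewrite -(subrKA g) rpredD.
Qed.

Canonical eqF0_equiv_rel := EquivRelPack eqF0_equiv.

Definition C0 := {eq_quot eqF0}.

HB.instance Definition _ : EqQuotient bop eqF0 C0 := EqQuotient.on C0.
HB.instance Definition _ := Choice.on C0.

Definition C0_pi (f : bop) : C0 := \pi f.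

Lemma C0W (P : C0 -> Prop) : (forall f, P (C0_pi f)) -> forall a, P a.
Proof. by move=> Pf; elim/quotW => f; exact: Pf. Qed.

Lemma C0P (f g : bop) : reflect (C0_pi f = C0_pi g) (f - g \in finite_rank).
Proof. exact: (eqmodP eqF0_equiv_rel). Qed.

Definition C0_zero : C0 := C0_pi 0.
Definition C0_one : C0 := C0_pi 1.
Definition C0_opp (a : C0) : C0 := C0_pi (- repr a).
Definition C0_add (a b : C0) : C0 := C0_pi (repr a + repr b).
Definition C0_mul (a b : C0) : C0 := C0_pi (repr a * repr b).

Lemma C0_repr (f : bop) : repr (C0_pi f) - f \in finite_rank.
Proof. by apply/C0P; rewrite /C0_pi reprK. Qed.

Fact C0_piN f : C0_opp (C0_pi f) = C0_pi (- f).
Proof. by apply/C0P; rewrite -opprD rpredN C0_repr. Qed.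

Fact C0_piD f g : C0_add (C0_pi f) (C0_pi g) = C0_pi (f + g).
Proof. by apply/C0P; rewrite opprD addrACA rpredD ?C0_repr. Qed.

Fact C0_piM f g : C0_mul (C0_pi f) (C0_pi g) = C0_pi (f * g).
Proof.
apply/C0P; set f' := repr _; set g' := repr _.
have -> : f' * g' - f * g = f' * (g' - g) + (f' - f) * g.
  by rewrite mulrBr mulrBl subrKA.
by apply: rpredD; [apply: finite_rankMl|apply: finite_rankMr]; exact: C0_repr.
Qed.

Fact C0_addA : associative C0_add.
Proof.
by elim/C0W=> f; elim/C0W=> g; elim/C0W=> h; rewrite !C0_piD addrA.
Qed.
Fact C0_addC : commutative C0_add.
Proof. by elim/C0W=> f; elim/C0W=> g; rewrite !C0_piD addrC. Qed.
Fact C0_add0 : left_id C0_zero C0_add.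
Proof. by elim/C0W=> f; rewrite C0_piD add0r. Qed.
Fact C0_addN : left_inverse C0_zero C0_opp C0_add.
Proof. by elim/C0W=> f; rewrite C0_piN C0_piD addNr. Qed.

HB.instance Definition _ :=
  GRing.isZmodule.Build C0 C0_addA C0_addC C0_add0 C0_addN.

Fact C0_mulA : associative C0_mul.
Proof.
by elim/C0W=> f; elim/C0W=> g; elim/C0W=> h; rewrite !C0_piM mulrA.
Qed.
Fact C0_mul1l : left_id C0_one C0_mul.
Proof. by elim/C0W=> f; rewrite C0_piM mul1r. Qed.
Fact C0_mul1r : right_id C0_one C0_mul.
Proof. by elim/C0W=> f; rewrite C0_piM mulr1. Qed.
Fact C0_mulDl : left_distributive C0_mul +%R.
Proof.
elim/C0W=> f; elim/C0W=> g; elim/C0W=> h.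
by rewrite -[_ + _]/(C0_add _ _) -[RHS]/(C0_add _ _) !(C0_piM, C0_piD) mulrDl.
Qed.
Fact C0_mulDr : right_distributive C0_mul +%R.
Proof.
elim/C0W=> f; elim/C0W=> g; elim/C0W=> h.
by rewrite -[_ + _]/(C0_add _ _) -[RHS]/(C0_add _ _) !(C0_piM, C0_piD) mulrDr.
Qed.

HB.instance Definition _ := GRing.Zmodule_isPzRing.Build C0
  C0_mulA C0_mul1l C0_mul1r C0_mulDl C0_mulDr.

Fact C0_pi_zmod_morphism : zmod_morphism C0_pi.
Proof.
by move=> f g; rewrite -[RHS]/(C0_add _ (C0_opp _)) C0_piN C0_piD.
Qed.
Fact C0_pi_monoid_morphism : monoid_morphism C0_pi.
Proof. by split=> // f g; rewrite -[RHS]/(C0_mul _ _) C0_piM. Qed.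

HB.instance Definition _ :=
  GRing.isZmodMorphism.Build bop C0 C0_pi C0_pi_zmod_morphism.
HB.instance Definition _ :=
  GRing.isMonoidMorphism.Build bop C0 C0_pi C0_pi_monoid_morphism.

End BoundedOperators.

Section ClosedSubspaces.
Variables (K : numFieldType) (X : normedModType K).

Record closed_subspace := ClosedSubspace {
  cs_set :> set X;
  cs_subspace : subspace_set cs_set;
  cs_closed : closed cs_set }.

Definition cs_pred (M : closed_subspace) : {pred X} := [pred x | x \in cs_set M].

(* The normed space carried by M, with the norm of X. *)
Record cs_type (M : closed_subspace) := CsType {
  cs_val : X;
  cs_valP : cs_val \in cs_pred M }.

Section CsStructure.
Variable M : closed_subspace.

Lemma cs_pred_submod_closed : submod_closed (cs_pred M).
Proof.
have [M0 MD] := cs_subspace M; split; first exact: mem_set.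
by move=> a x y /set_mem Mx /set_mem My; apply/mem_set/MD.
Qed.

HB.instance Definition _ :=
  GRing.isSubmodClosed.Build K X (cs_pred M) cs_pred_submod_closed.
HB.instance Definition _ := [isSub of cs_type M for @cs_val M].
HB.instance Definition _ := [Choice of cs_type M by <:].
HB.instance Definition _ := [SubChoice_isSubLmodule of cs_type M by <:].

Let cs_norm (x : cs_type M) : K := `|cs_val x|.

Fact cs_ler_normD (x y : cs_type M) : cs_norm (x + y) <= cs_norm x + cs_norm y.
Proof. exact: ler_normD. Qed.
Fact cs_normrZ (l : K) (x : cs_type M) : cs_norm (l *: x) = `|l| * cs_norm x.
Proof. exact: normrZ. Qed.
Fact cs_normr0_eq0 (x : cs_type M) : cs_norm x = 0 -> x = 0.
Proof. by move=> /normr0_eq0 x0; exact: val_inj. Qed.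

HB.instance Definition _ := Lmodule_isNormed.Build K (cs_type M)
  cs_ler_normD cs_normrZ cs_normr0_eq0.

Lemma cs_normE (x : cs_type M) : `|x| = `|cs_val x|. Proof. by []. Qed.

End CsStructure.
End ClosedSubspaces.

Section ClosedSubspaceComplete.
Variables (K : numFieldType) (X : completeNormedModType K).
Variable M : closed_subspace X.

Fact cs_complete (F : set_system (cs_type M)) :
  ProperFilter F -> cauchy F -> cvg F.
Proof.
move=> FF cF; pose G := (@cs_val K X M) @ F.
have cG : cauchy G.
  apply/cauchy_ballP => e e0; have /cauchy_ballP/(_ e e0) := cF.
  rewrite !near_simpl => -[[P Q] /= [FP FQ] PQ].
  exists (@cs_val K X M @` P, @cs_val K X M @` Q) => /=.
    by split; rewrite /G /=; [apply: filterS FP|apply: filterS FQ] => x;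
      exists x.
  move=> [_ _] /= [[x Px <-] [y Qy <-]].
  have := PQ (x, y) (conj Px Qy).
  by rewrite /= -!ball_normE.
have /cvg_ex[l Gl] : cvg G by exact: cauchy_cvg.
have Ml : cs_set M l.
  have MF : \forall x \near F, cs_set M (cs_val x).
    by apply: nearW => x; apply: set_mem; exact: cs_valP.
  exact: (@closed_cvg _ _ F FF (@cs_val K X M) _ (@cs_closed _ _ M) MF l Gl).
apply/cvg_ex; exists (CsType (mem_set Ml : l \in cs_pred M)).
apply/cvgrPdist_lt => e e0.
by move/cvgrPdist_lt : Gl => /(_ e e0).
Qed.

HB.instance Definition _ := Uniform_isComplete.Build (cs_type M) cs_complete.

End ClosedSubspaceComplete.

Section Restriction.
Variables (K : numFieldType) (X : normedModType K).
Implicit Types (T : bop X) (M N : closed_subspace X).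

Definition invariant T M : Prop := T @` M `<=` M.

Definition restr_fun T M (TM : invariant T M) (x : cs_type M) : cs_type M :=
  CsType (mem_set (TM _ (imageP T (set_mem (cs_valP x)))) : _ \in cs_pred M).

Fact restr_bounded T M (TM : invariant T M) :
  restr_fun TM \in @bounded_op K (cs_type M).
Proof.
have [_ [C TC]] := bopP T; apply/asboolP; split.
  by move=> a x y; apply: val_inj; rewrite /= linearP.
by exists C => x; exact: TC.
Qed.

Definition restr T M (TM : invariant T M) : bop (cs_type M) :=
  Bop (restr_bounded TM).

Definition direct_sum M N : Prop :=
  M `&` N = [set 0] /\
  forall x, exists2 m, cs_set M m & exists2 n, cs_set N n & x = m + n.

End Restriction.

Section SemiFredholm.
Variable K : numFieldType.

Definition left_semi_Fredholm (Y : completeNormedModType K) (U : bop Y) : Prop :=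
  [/\ closed (range U), finite_dim (kernel U) &
      exists P : bop Y, P * P = P /\ range P = range U].

Variable X : completeNormedModType K.

Definition left_semi_B_Fredholm (T : bop X) : Prop :=
  left_Drazin_invertible (C0_pi T).

Definition nilpotent_left_semi_Fredholm (T : bop X) : Prop :=
  exists (M N : closed_subspace X) (TM : invariant T M) (TN : invariant T N),
    [/\ direct_sum M N, nilpotent (restr TM) & left_semi_Fredholm (restr TN)].

End SemiFredholm.

(* Main.v *)
Require Import Defs.
From HB Require Import structures.
From mathcomp Require Import all_boot all_order all_algebra.
From mathcomp Require Import complex ring.
From mathcomp Require Import all_classical reals topology normedtype sequences.

(** Write A for the ring L(X) and J for the ideal of finite rank operators.
N(u) and R(u) are the kernel and the range of u, and statements modulo J are
statements in the quotient A / J.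

From (1) to (2) the argument takes place in A and uses three facts about J
([regular_dcc_ideal]): each x in J has an inner inverse, x = x z x; and a
chain of elements of J in which each term is a right multiple (or each a left
multiple) of the preceding one is stationary at some step.  Hence an element
with a power in J is Drazin invertible, and idempotents lift modulo J
([idempotent_lift]).  Lifting the idempotent of (1), and moving the invertible
part of its corner to the other side ([nilpotent_corner]), gives an idempotent
p of A such that T is nilpotent on M = R(p) and left invertible modulo J on
N = R(1 - p), up to two couplings M -> N and N -> M of finite rank.  For fixed
M and N, no change of complement removes both couplings in general:
finite-dimensional pieces have to move between M and N.
- [lower_triangular]: the range of the coupling N -> M generates under T a
  finite-dimensional subspace of M.  Moved to N, it makes N invariant.
- [kato_reduction]: as in Kato's decomposition of semi-Fredholm operators,
  the finite-dimensional nilpotent summands of T on N are moved to M, until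
  N(T|N) lies in R((T|N)^m) for an m with p T^m = 0.
- [splitting_lower_triangular]: for the remaining coupling f : M -> N, a
  Sylvester equation makes R(f) independent of R(T|N).  Then the vectors of M
  killed by all f m^i, where m is the compression of T to M, form an invariant
  subspace W on which T is nilpotent.  W has an invariant complement, given by
  a second Sylvester equation, solvable thanks to the position of N(T|N).
The outcome ([kato_type_splitting]) is an idempotent E commuting with T, with
T nilpotent on R(E) and left invertible modulo J on N(E).  An element left
invertible modulo J has an inner inverse, which yields the projection onto the
range of T on N(E), and its kernel has finite dimension.

From (2) to (1), the closed graph theorem, deduced from Baire's theorem, makes
the projection E onto M along N bounded.  Applied once more, it gives an
operator L which inverts T on N up to the finite rank projection onto N(T|N).
Then (1 + T E)^-1 on M and L on N form a left inverse of T + E modulo J.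

The inner inverses of finite rank operators come from the Hahn-Banach theorem,
which provides bounded coordinates on finite-dimensional subspaces.  Both
theorems of functional analysis are proved over the reals; complex spaces are
reduced to real ones by restriction of scalars. *)

Set Implicit Arguments.
Unset Strict Implicit.
Unset Printing Implicit Defensive.

Import Order.TTheory GRing.Theory Num.Theory.
Import numFieldNormedType.Exports.

Local Open Scope classical_set_scope.
Local Open Scope ring_scope.

(** * Drazin inverses and regular ideals with chain conditions *)

Section RegularIdeal.
Variable A : pzRingType.

Definition drazin_inverse (x y : A) : Prop :=
  [/\ x * y = y * x, y * x * y = y & exists m, x ^+ m * (x * y) = x ^+ m].

Lemma idem_expS (e : A) n : e * e = e -> e ^+ n.+1 = e.
Proof. by move=> ee; elim: n => [|n IH]; rewrite ?expr1// exprS IH. Qed.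

(** The idempotent e = x y is both x^(m+1) y^(m+1) and y^(m+1) x^(m+1).  As f
passes through the powers of x, this gives f e = e f e = e f, and y is the
inverse of x in the corner cut out by e. *)
Lemma drazin_comm (x y f : A) :
  drazin_inverse x y -> f * x = x * f -> f * y = y * f.
Proof.
move=> [xy yxy [m xm]] fx.
have fxm i : f * x ^+ i = x ^+ i * f by apply: commrX.
pose e := x * y.
have ee : e * e = e by rewrite /e -mulrA (mulrA y) yxy.
have em : e = x ^+ m.+1 * y ^+ m.+1.
  by rewrite -exprMn_comm// idem_expS.
have em' : e = y ^+ m.+1 * x ^+ m.+1.
  by rewrite -exprMn_comm// -xy idem_expS.
have xme : x ^+ m.+1 * e = x ^+ m.+1 by rewrite exprS -mulrA xm.
have emx : e * x ^+ m.+1 = x ^+ m.+1.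
  rewrite -[RHS]xme; apply: commrX; rewrite /GRing.comm /e -mulrA -xy //.
have fe : f * e = e * f * e.
  by rewrite [in LHS]em mulrA fxm -emx -!mulrA (mulrA (x ^+ _) f) -fxm -!mulrA -em.
have ef : e * f = e * f * e.
  by rewrite [in LHS]em' -mulrA -fxm -[in LHS]xme !mulrA -(mulrA _ f) fxm !mulrA -em'.
have efe : e * f = f * e by rewrite fe -ef.
have ye : y * e = y by rewrite /e mulrA.
have ey : e * y = y by rewrite /e xy.
have <- : y * e * f = y * f by rewrite ye.
by rewrite -mulrA efe {1}/e !mulrA -(mulrA y) fx mulrA -xy -/e efe -mulrA ey.
Qed.

(** The inverse is x^m u^(m+1) = v^(m+1) x^m. *)
Lemma strongly_pi_regular_drazin (x u v : A) m :
  x ^+ m = x ^+ m.+1 * u -> x ^+ m = v * x ^+ m.+1 ->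
  exists y, drazin_inverse x y.
Proof.
move=> xu xv.
have xui i : x ^+ m = x ^+ (m + i) * u ^+ i.
  elim: i => [|i IH]; first by rewrite addn0 mulr1.
  by rewrite {1}IH addnC exprD {1}xu mulrA -exprD -mulrA -exprS addnC addSnnS.
have xvi i : x ^+ m = v ^+ i * x ^+ (m + i).
  elim: i => [|i IH]; first by rewrite addn0 mul1r.
  by rewrite {1}IH exprD {1}xv mulrA mulrA -exprSr -mulrA -exprD addSnnS.
have yE : x ^+ m * u ^+ m.+1 = v ^+ m.+1 * x ^+ m.
  by rewrite {1}(xvi m.+1) [in RHS](xui m.+1) mulrA.
have xuE : x * (x ^+ m * u ^+ m.+1) = x ^+ m * u ^+ m.
  by rewrite mulrA -exprS (exprS u) mulrA -xu.
have xvE : v ^+ m.+1 * x ^+ m * x = v ^+ m * x ^+ m.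
  by rewrite -mulrA -exprSr (exprSr v) -mulrA -xv.
have uv : x ^+ m * u ^+ m = v ^+ m * x ^+ m.
  by rewrite {1}(xvi m) [in RHS](xui m) mulrA.
exists (x ^+ m * u ^+ m.+1); split.
- by rewrite xuE uv yE xvE.
- by rewrite {1}yE xvE mulrA -(mulrA (v ^+ m)) -exprD -xvi.
- by exists m; rewrite xuE mulrA -exprD -xui.
Qed.

(** McCoy's lemma: an inner inverse modulo a regular ideal can be corrected to
an inner inverse. *)
Lemma mccoy (t l z : A) : t - t * l * t = (t - t * l * t) * z * (t - t * l * t) ->
  exists s, t = t * s * t.
Proof.
move=> E; exists (l + (1 - l * t) * z * (1 - t * l)).
have E1 : t - t * l * t = t * (1 - l * t) by rewrite mulrBr mulr1 mulrA.
have E2 : t - t * l * t = (1 - t * l) * t by rewrite mulrBl mul1r.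
rewrite mulrDr mulrDl -[LHS](subrK (t * l * t)) addrC E; congr (_ + _).
by rewrite {1}E1 E2 !mulrA.
Qed.

(** What the ideal of finite rank operators retains of finite dimension.  One
stationary step is asked of a chain, not a stationary tail: this is what
counting dimensions proves directly, and it is all that is used. *)
Record regular_dcc_ideal (J : A -> Prop) : Prop := RegularDccIdeal {
  rdiB : forall x y, J x -> J y -> J (x - y);
  rdiMl : forall a x, J x -> J (a * x);
  rdiMr : forall a x, J x -> J (x * a);
  rdi_regular : forall x, J x -> exists z, x = x * z * x;
  rdi_dccr : forall x : nat -> A, J (x 0%N) ->
    (forall i, exists w, x i.+1 = x i * w) -> exists i w, x i = x i.+1 * w;
  rdi_dccl : forall x : nat -> A, J (x 0%N) ->
    (forall i, exists w, x i.+1 = w * x i) -> exists i w, x i = w * x i.+1 }.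

Variable J : A -> Prop.
Hypothesis Jfin : regular_dcc_ideal J.
Let JMl a x : J x -> J (a * x). Proof. by move/(rdiMl Jfin). Qed.
Let JMr a x : J x -> J (x * a). Proof. by move/(rdiMr Jfin). Qed.
Let JB x y : J x -> J y -> J (x - y). Proof. exact: (rdiB Jfin). Qed.

(** The powers of x from x^n on form a chain on either side, so that x is
strongly pi-regular. *)
Lemma drazin_exists x n : J (x ^+ n) -> exists y, drazin_inverse x y.
Proof.
move=> Jx.
have [|i|i [u xu]] := rdi_dccr Jfin (x := fun i => x ^+ (n + i)).
- by rewrite addn0.
- by exists x; rewrite addnS exprSr.
have [|j|j [v xv]] := rdi_dccl Jfin (x := fun i => x ^+ (n + i)).
- by rewrite addn0.
- by exists x; rewrite addnS exprS.
apply: (@strongly_pi_regular_drazin x u v (n + i + j)%N).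
  rewrite /= in xu; rewrite addnC exprD {1}xu mulrA -exprD.
  by congr (x ^+ _ * u); rewrite !addnS.
rewrite /= in xv; rewrite addnAC exprD {1}xv -mulrA -exprD.
by congr (_ * x ^+ _); rewrite !addnS.
Qed.

Lemma rdi0 x : J x -> J 0. Proof. by move=> Jx; rewrite -(subrr x); apply: JB. Qed.
Lemma rdiN x : J x -> J (- x).
Proof. by move=> Jx; rewrite -sub0r; apply: JB => //; apply: rdi0 Jx. Qed.
Lemma rdiD x y : J x -> J y -> J (x + y).
Proof. by move=> Jx Jy; rewrite -[y]opprK; apply: JB => //; apply: rdiN. Qed.

(** [J (x - y)] is read as x = y modulo J. *)
Lemma rdi_eqC x y : J (x - y) -> J (y - x).
Proof. by move/rdiN; rewrite opprB. Qed.
Lemma rdi_eq_trans x y z : J (x - y) -> J (y - z) -> J (x - z).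
Proof. by move=> xy yz; rewrite -(subrKA y); apply: rdiD. Qed.
Lemma rdi_eqM a b c d : J (a - b) -> J (c - d) -> J (a * c - b * d).
Proof.
move=> ab cd; have -> : a * c - b * d = a * (c - d) + (a - b) * d.
  by rewrite mulrBr mulrBl subrKA.
by apply: rdiD; [apply: JMl|apply: JMr].
Qed.
Lemma rdi_eqX a b n : J (a - b) -> J (a ^+ n - b ^+ n).
Proof.
move=> ab; elim: n => [|n IH]; first by rewrite subrr; apply: rdi0 ab.
by rewrite !exprS; apply: rdi_eqM.
Qed.
Lemma rdi_idemX f n : J (f * f - f) -> J (f ^+ n.+1 - f).
Proof.
move=> ff; elim: n => [|n IH]; first by rewrite expr1 subrr; apply: rdi0 ff.
apply: rdi_eq_trans ff; rewrite exprS; apply: rdi_eqM => //.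
by rewrite subrr; apply: rdi0 IH.
Qed.

(** The power b^j is a left inverse of a^j modulo J, so a^j - a^j b^j a^j is in J
and McCoy's lemma applies. *)
Lemma left_invertible_pow_regular a b j : J (b * a - 1) ->
  exists s, a ^+ j = a ^+ j * s * a ^+ j.
Proof.
move=> ba.
have bja : J (b ^+ j * a ^+ j - 1).
  elim: j => [|j IH]; first by rewrite mulr1 subrr; apply: rdi0 ba.
  rewrite exprSr exprS mulrA -(mulrA _ b).
  apply: rdi_eq_trans IH; apply: rdi_eqM; last by rewrite subrr; apply: rdi0 ba.
  rewrite -[X in _ - X]mulr1; apply: rdi_eqM => //.
  by rewrite subrr; apply: rdi0 ba.
have : J (a ^+ j - a ^+ j * b ^+ j * a ^+ j).
  by rewrite -mulrA -[X in X - _]mulr1 -mulrBr; apply: JMl; apply: rdi_eqC.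
by move=> /(rdi_regular Jfin)[z]; apply: mccoy.
Qed.

(** The element g = f (1 - f) of J is Drazin invertible.  Away from its spectral
idempotent e, x = f (1 - e) satisfies x^M (1 - x)^M = 0 for some M, and
P = 1 - (1 - x^M)^M is divisible by x^M while 1 - P is divisible by
(1 - x)^M. *)
Lemma idempotent_lift f : J (f * f - f) ->
  exists P, P * P = P /\ J (P - f).
Proof.
move=> ff; pose g := f - f * f.
have Jg : J g by apply: rdi_eqC.
have [|y gy] := @drazin_exists g 1; first by rewrite expr1.
have fg : f * g = g * f by rewrite /g mulrBr mulrBl mulrA.
have fy := drazin_comm gy fg.
have [gyC ygy [m gm]] := gy.
pose e := g * y.
have ee : e * e = e by rewrite /e -mulrA (mulrA y) ygy.
have fe : f * e = e * f by rewrite /e mulrA fg -mulrA fy mulrA.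
have Je : J e by apply: JMr.
pose x := f * (1 - e).
have f1e : f * (1 - e) = (1 - e) * f by rewrite mulrBr mulrBl mulr1 mul1r fe.
have e1 : (1 - e) * (1 - e) = 1 - e.
  by rewrite mulrBr mulr1 mulrBl mul1r ee subrr subr0.
have xx : x * (1 - x) = g * (1 - e).
  rewrite mulrBr mulr1 {2}/x {2}/x {2}f1e mulrA -(mulrA f) e1 -mulrA -f1e mulrA.
  by rewrite /x -mulrBl.
have ge : g * e = e * g by rewrite /e -[RHS]mulrA -gyC.
have ge1 : g * (1 - e) = (1 - e) * g by rewrite mulrBr mulr1 [RHS]mulrBl mul1r ge.
have xM0 : x ^+ m.+1 * (1 - x) ^+ m.+1 = 0.
  rewrite -exprMn_comm; last by rewrite /GRing.comm mulrBr mulrBl mulr1 mul1r.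
  rewrite xx exprMn_comm// (idem_expS _ e1) mulrBr mulr1 exprS -mulrA /e gm subrr //.
have [w PE] : exists w, 1 - (1 - x ^+ m.+1) ^+ m.+1 = w * x ^+ m.+1.
  set u := x ^+ m.+1; elim: (m.+1) => [|n [w IH]].
    by exists 0; rewrite expr0 subrr mul0r.
  exists (w + (1 - u) ^+ n); rewrite mulrDl -IH exprSr mulrBr mulr1 opprB addrA.
  by rewrite addrAC.
have [w' QE] : exists w', (1 - x ^+ m.+1) ^+ m.+1 = (1 - x) ^+ m.+1 * w'.
  exists ((\sum_(i < m.+1) x ^+ i) ^+ m.+1).
  rewrite -exprMn_comm; last first.
    apply: commr_sum => i _; apply/commr_sym/commrB; first exact: commr1.
    by apply/commr_sym/commrX.
  by congr (_ ^+ _); rewrite -[LHS]opprB subrX1 -mulNr opprB.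
set P := (1 - (1 - _) ^+ _) in PE.
exists P; split.
  apply/esym/eqP; rewrite -subr_eq0 -[X in X - _]mulr1 -mulrBr.
  by rewrite {2}/P subKr PE QE mulrA -(mulrA w) xM0 mulr0 mul0r.
have xf : J (x - f).
  by rewrite /x mulrBr mulr1 addrAC subrr sub0r; apply/rdiN/JMl.
have x2 : J (x ^+ m.+1 - f).
  by apply: rdi_eq_trans (rdi_idemX m ff); apply: rdi_eqX.
have x3 : J ((1 - x ^+ m.+1) - (1 - f)).
  by rewrite opprB addrC subrKA; apply: rdi_eqC.
have x4 : J ((1 - x ^+ m.+1) ^+ m.+1 - (1 - f)).
  apply: rdi_eq_trans (rdi_eqX m.+1 x3) _; apply: rdi_idemX.
  by rewrite mulrBr mulr1 mulrBl mul1r opprB addrC addKr.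
by rewrite /P addrAC; apply: rdi_eqC.
Qed.

(** Finitely generated right ideals in J are generated by an idempotent.  For
operators, d is a projection onto the sum of the ranges of the x i; the
last equation lets invariance be checked on generators. *)
Lemma right_ideal_gen (x : nat -> A) k : (forall i, J (x i)) ->
  exists d (y : nat -> A), [/\ d * d = d, J d,
    forall i, (i < k)%N -> d * x i = x i & d = \sum_(i < k) x i * y i].
Proof.
move=> Jx; elim: k => [|k [d [y [dd Jd dx dE]]]].
  exists 0, (fun=> 0); split; rewrite ?mulr0 ?big_ord0//; exact: rdi0 (Jx 0%N).
(* the contribution of x k outside the range of d *)
pose x' := x k - d * x k.
have [|z x'E] := rdi_regular Jfin (x := x').
  by apply: JB => //; apply: JMl.
pose f := x' * z.
have df : d * f = 0 by rewrite /f mulrA mulrBr mulrA dd subrr mul0r.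
have ff : f * f = f by rewrite /f mulrA -x'E.
exists (d + f * (1 - d)).
pose c := x k * (z * (1 - d)).
have dE' : d + f * (1 - d) = d - d * c + c.
  by rewrite /f /x' /c mulrBl mulrBl -!mulrA addrAC addrA.
exists (fun i => if (i < k)%N then y i - y i * c else z * (1 - d)).
split.
- have d1 : (1 - d) * d = 0 by rewrite mulrBl mul1r dd subrr.
  have d1f : (1 - d) * f = f by rewrite mulrBl mul1r df subr0.
  rewrite mulrDl (mulrDr d) dd (mulrA d) df mul0r addr0; congr (_ + _).
  by rewrite mulrDr -mulrA d1 mulr0 add0r -mulrA (mulrA (1 - d)) d1f mulrA ff.
- by apply: rdiD => //; do 2!apply: JMr; apply: JB => //; apply: JMl.
- move=> i; rewrite ltnS leq_eqVlt => /orP[/eqP->|ik].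
    by rewrite mulrDl -mulrA [(1 - d) * _]mulrBl mul1r -/x' /f -x'E addrC subrK.
  by rewrite mulrDl dx// -mulrA mulrBl mul1r dx// subrr mulr0 addr0.
- rewrite big_ord_recr /= ltnn dE'; congr (_ + _).
  under eq_bigr => i _ do rewrite ltn_ord mulrBr mulrA.
  by rewrite sumrB -mulr_suml -dE.
Qed.

End RegularIdeal.

(** * Removing the coupling between the nilpotent and the left invertible part *)

Section Splitting.
Variable A : pzRingType.
Variable J : A -> Prop.
Hypothesis Jfin : regular_dcc_ideal J.
Let JMl a x : J x -> J (a * x). Proof. by move/(rdiMl Jfin). Qed.
Let JMr a x : J x -> J (x * a). Proof. by move/(rdiMr Jfin). Qed.
Let JB x y : J x -> J y -> J (x - y). Proof. exact: (rdiB Jfin). Qed.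

Let JD x y : J x -> J y -> J (x + y). Proof. exact: (rdiD Jfin). Qed.
Let JN x : J x -> J (- x). Proof. exact: (rdiN Jfin). Qed.
Let eqC x y : J (x - y) -> J (y - x). Proof. exact: (rdi_eqC Jfin). Qed.
Let eqT x y z : J (x - y) -> J (y - z) -> J (x - z).
Proof. exact: (rdi_eq_trans Jfin). Qed.
Let eqM a b c d : J (a - b) -> J (c - d) -> J (a * c - b * d).
Proof. exact: (rdi_eqM Jfin). Qed.

(** The notion is left-right symmetric: results on right ideals transfer to left
ideals. *)
Lemma regular_dcc_ideal_converse : @regular_dcc_ideal A^c J.
Proof.
split.
- exact: (rdiB Jfin).
- by move=> a x; apply: (rdiMr Jfin).
- by move=> a x; apply: (rdiMl Jfin).
- by move=> x /(rdi_regular Jfin)[z xz]; exists z; rewrite [LHS]xz; exact: (esym (@mulrA A x z x)).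
- exact: (rdi_dccl Jfin).
- exact: (rdi_dccr Jfin).
Qed.

Lemma left_ideal_gen (x : nat -> A) k : (forall i, J (x i)) ->
  exists d (y : nat -> A), [/\ d * d = d, J d,
    forall i, (i < k)%N -> x i * d = x i & d = \sum_(i < k) y i * x i].
Proof. exact: (@right_ideal_gen A^c J regular_dcc_ideal_converse). Qed.

(** The compression x = P t P has a power in J, hence a Drazin inverse.  The
idempotent e on which x is invertible is in J, and x is nilpotent on P - e. *)
Lemma nilpotent_corner (P t b : A) n : P * P = P -> J (t * P - P * t) ->
    J (b * t + b * P - 1) -> J ((t * P) ^+ n) ->
  exists p b' k, [/\ p * p = p, (p * t * p) ^+ k.+1 = 0, J (t * p - p * t) &
    J (b' * t - (1 - p))].
Proof.
move=> PP tP bt nt.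
have J0 : J 0 by apply: (rdi0 Jfin tP).
have J00 a : J (a - a) by rewrite subrr.
pose x := P * t * P.
have xP : x * P = x by rewrite /x -!mulrA PP.
have Px : P * x = x by rewrite /x !mulrA PP.
have xtP : J (x - t * P).
  have -> : x - t * P = (P * t - t * P) * P by rewrite mulrBl -/x -(mulrA t) PP.
  by apply: JMr; apply: eqC.
have xn : J (x ^+ n).
  by rewrite -(subrK ((t * P) ^+ n) (x ^+ n)); apply: JD => //; apply: (rdi_eqX Jfin).
have [y xy] := drazin_exists Jfin xn.
have Py := drazin_comm xy (etrans Px (esym xP)).
have [xyC yxy [m xm]] := xy.
pose e := x * y.
have ee : e * e = e by rewrite /e -mulrA (mulrA y) yxy.
have Je : J e.
  by rewrite -(idem_expS n ee) /e exprMn_comm// exprSr -mulrA; apply: JMr.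
have Pe : P * e = e by rewrite /e mulrA Px.
have eP : e * P = e by rewrite /e -mulrA -Py mulrA xP.
have xe : x * e = e * x by rewrite /e -[RHS]mulrA -xyC.
pose p := P - e.
have pp : p * p = p by rewrite mulrBl !mulrBr PP Pe eP ee subrr subr0.
have px : p * x = x * p by rewrite mulrBl mulrBr Px xP xe.
have pP : J (p - P) by rewrite /p addrAC subrr sub0r; apply: JN.
have tp : J (t * p - p * t).
  apply: eqT (_ : J (t * P - p * t)); first by apply: eqM.
  by apply: eqT tP _; apply: eqM => //; apply: eqC.
exists p, (b * (1 - P)), m; split=> //.
- have pP' : p * P = p by rewrite mulrBl PP eP.
  have Pp : P * p = p by rewrite mulrBr PP Pe.
  have -> : p * t * p = x * p.
    have -> : x * p = p * x * p by rewrite px -mulrA pp.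
    by rewrite -{1}pP' -{2}Pp /x !mulrA.
  rewrite exprMn_comm// (idem_expS _ pp) /p mulrBr exprSr -mulrA xP.
  by rewrite -mulrA xe mulrA xm subrr.
- apply: eqT (_ : J ((1 - P) - (1 - p))); last first.
    by rewrite opprB addrC subrKA; apply: eqC; apply: eqC.
  apply: eqT (_ : J (b * t * (1 - P) - (1 - P))).
    rewrite -!mulrA -mulrBr; apply: JMl.
    by rewrite mulrBr mulrBl mulr1 mul1r opprB addrC subrKA; apply: eqC; apply: eqC.
  have -> : b * t * (1 - P) = (b * t + b * P) * (1 - P).
    have P1 : P * (1 - P) = 0 by rewrite mulrBr mulr1 PP subrr.
    by rewrite [RHS]mulrDl -(mulrA b P) P1 mulr0 addr0.
  by rewrite -[X in _ - X]mul1r -mulrBl; apply: JMr.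
Qed.

(** With m = p t p and F = p t (1 - p), the idempotent d projects onto the sum of
the ranges of the m^i F, the least m-invariant right ideal that contains the
coupling F.  It is in J; subtracting d p from p absorbs the coupling. *)
Lemma lower_triangular (p t b : A) k :
    p * p = p -> (p * t * p) ^+ k.+1 = 0 -> J (t * p - p * t) ->
    J (b * t - (1 - p)) ->
  exists q, [/\ q * q = q, q * t * (1 - q) = 0, q * t ^+ k.+1 = 0,
    J (t * q - q * t) & J (b * t - (1 - q))].
Proof.
move=> pp mk0 tp bt.
have J0 : J 0 by exact: (rdi0 Jfin tp).
have J00 a : J (a - a) by rewrite subrr.
set m := p * t * p in mk0.
have pm : p * m = m by rewrite /m !mulrA pp.
have mp : m * p = m by rewrite /m -!mulrA pp.
pose F := p * t * (1 - p).
have pF : p * F = F by rewrite /F !mulrA pp.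
have JF : J F.
  have -> : F = (p * t - t * p) * (1 - p).
    by rewrite /F mulrBl -(mulrA t) [p * (1 - p)]mulrBr mulr1 pp subrr mulr0 subr0.
  by apply: JMr; apply: eqC.
have [|d [y [dd Jd dx dE]]] := right_ideal_gen Jfin (x := fun i => m ^+ i * F) k.+1.
  by move=> i; apply: JMl.
have pmF i : p * (m ^+ i * F) = m ^+ i * F.
  have pmi : p * m ^+ i = m ^+ i * p by apply: commrX; rewrite /GRing.comm pm mp.
  by rewrite mulrA pmi -mulrA pF.
have pd : p * d = d.
  by rewrite dE mulr_sumr; apply: eq_bigr => i _; rewrite mulrA pmF.
have dmd : d * m * d = m * d.
  rewrite {2 3}dE !mulr_sumr; apply: eq_bigr => i _ /=.
  have mF : m * (m ^+ i * F * y i) = m ^+ i.+1 * F * y i by rewrite exprS !mulrA.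
  rewrite -mulrA mF.
  have [ik|ik] := ltnP i.+1 k.+1; first by rewrite mulrA dx.
  have -> : (i.+1 = k.+1)%N by apply/eqP; rewrite eqn_leq ik ltn_ord.
  by rewrite mk0 !(mul0r, mulr0).
have dF : d * F = F by have := dx 0%N isT; rewrite expr0 mul1r.
pose e := d * p.
have pe : p * e = e by rewrite /e mulrA pd.
have ep : e * p = e by rewrite /e -mulrA pp.
have ee : e * e = e by rewrite {2}/e mulrA /e -(mulrA d p) pd dd.
pose q := p - e.
have qE : q = (1 - d) * p by rewrite mulrBl mul1r.
have qq : q * q = q by rewrite /q mulrBl !mulrBr pp pe ep ee subrr subr0.
have qt1 : q * t * (1 - q) = 0.
  have -> : 1 - q = (1 - p) + p * e by rewrite pe opprB addrA addrAC.
  have -> : q * t * ((1 - p) + p * e) = (1 - d) * F + (1 - d) * m * e.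
    by rewrite qE mulrDr /F /m !mulrA.
  rewrite mulrBl mul1r dF subrr add0r /e mulrA -(mulrA _ m) mulrBl mul1r mulrA.
  by rewrite dmd subrr mul0r.
have Je : J e by apply: JMr.
have qp : J (q - p) by rewrite /q addrAC subrr sub0r; apply: JN.
exists q; split=> //.
- have d1md : (1 - d) * m * d = 0 by rewrite -mulrA mulrBl mul1r mulrA dmd subrr.
  have d1q : (1 - d) * q = q.
    by rewrite /q /e mulrBr mulrBl mul1r mulrBl mul1r mulrA dd subrr subr0.
  have qtq : q * t = (1 - d) * m * q.
    rewrite -[LHS]subr0 -qt1 mulrBr mulr1 subKr.
    have pq : p * q = q by rewrite /q mulrBr pp pe.
    by rewrite {1}qE -{1}pq /m !mulrA.
  move: (m) mk0 qtq d1md => {F pF JF dx dE pmF dmd dF qt1 pm mp} {}m mk0 qtq d1md.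
  have qtj j : q * t ^+ j = (1 - d) * m ^+ j * q.
    elim: j => [|j IH]; first by rewrite !mulr1 d1q.
    rewrite exprS mulrA qtq -!mulrA IH !mulrA; congr (_ * _).
    have -> : (1 - d) * m * (1 - d) = (1 - d) * m.
      by rewrite [LHS]mulrBr mulr1 d1md subr0.
    by rewrite -mulrA -exprS.
  by rewrite qtj mk0 mulr0 mul0r.
- apply: eqT (_ : J (t * p - q * t)); first exact: eqM.
  by apply: eqT tp _; apply: eqM => //; apply: eqC.
- apply: eqT bt _; rewrite opprB addrC subrKA; exact: qp.
Qed.

Section Kato.
Variables a b : A.
Hypothesis ba : J (b * a - 1).

Lemma inner_inverse : exists2 s, a = a * s * a & J (1 - s * a).
Proof.
have [s] := left_invertible_pow_regular Jfin 1 ba; rewrite expr1 => asa.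
exists s => //; apply: eqC; apply: eqT (_ : J (b * a * (s * a) - 1)).
  by rewrite -[X in X - _]mul1r -mulrBl; apply: JMr; apply: eqC.
by rewrite -mulrA (mulrA a) -asa.
Qed.

(** For operators, r is a projection onto N(a): the elements x with a x = 0 are
the operators with range in N(a). *)
Lemma kernel_generator : exists r, [/\ J r, a * r = 0 & forall x, a * x = 0 -> r * x = x].
Proof.
have [s asa Jr] := inner_inverse; exists (1 - s * a); split=> //.
- by rewrite mulrBr mulr1 mulrA -asa subrr.
- by move=> x ax; rewrite mulrBl mul1r -mulrA ax mulr0 subr0.
Qed.

(** For operators, x is a projection onto the intersection of N(a) and R(a^j). *)
Lemma kernel_cap_power_generator j : exists x, [/\ J x, a * x = 0,
  exists y, x = a ^+ j * y & forall v y, a * v = 0 -> v = a ^+ j * y -> x * v = v].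
Proof.
have [s asa] := left_invertible_pow_regular Jfin j ba.
have [r [Jr ar rx]] := kernel_generator.
pose g := a ^+ j * s.
have [|z xz] := rdi_regular Jfin (x := (1 - g) * r); first exact: JMl.
exists (r - r * z * ((1 - g) * r)); split.
- by apply: JB => //; do 2!apply: JMr.
- by rewrite mulrBr !mulrA ar !mul0r subrr.
- exists (s * (r - r * z * ((1 - g) * r))); rewrite (mulrA (a ^+ j)) -/g.
  have : (1 - g) * (r - r * z * ((1 - g) * r)) = 0.
    by rewrite !mulrA in xz; rewrite [LHS]mulrBr !mulrA -xz subrr.
  by rewrite [X in X = _ -> _]mulrBl mul1r => /subr0_eq.
- move=> v y av vy.
  have gv : (1 - g) * v = 0 by rewrite mulrBl mul1r {2}vy mulrA -asa -vy subrr.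
  by rewrite mulrBl -!mulrA rx// gv !mulr0 subr0.
Qed.

(** The intersections of N(a) with R(a^i) decrease; the chain condition along the
multiples of k makes them constant on an interval of length k. *)
Lemma kernel_cap_power_stable k : exists i, forall v y, a * v = 0 ->
  v = a ^+ i * y -> exists y', v = a ^+ (i + k) * y'.
Proof.
have [x xP] := choice (fun i => kernel_cap_power_generator (i * k)%N).
have [| |i [w xw]] := rdi_dccr Jfin (x := x).
- by have [] := xP 0%N.
- move=> i; exists (x i.+1); have [_ _ _ xv] := xP i.
  have [_ ax [y xy] _] := xP i.+1.
  by rewrite (xv _ (a ^+ k * y) ax)// mulrA -exprD addnC -mulSn.
exists (i * k)%N => v y av vy; have [_ _ _ xv] := xP i.
have [_ _ [y' xy'] _] := xP i.+1.
by exists (y' * w * v); rewrite -[LHS](xv v y av vy) xw xy' mulSnr !mulrA.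
Qed.

(** Induction on j.  The part of N(a) inside R(a^j) and outside R(a^(j+1))
consists of ends of Jordan chains of length j + 1.  These chains span a direct
summand: E below is a combination that commutes with a and has its range in
their span, and the spectral idempotent of E is the projection that splits
them off. *)
Lemma kato_strip j : exists e, [/\ e * e = e, J e, e * a = a * e, a ^+ j * e = 0 &
  forall x, a * x = 0 -> e * x = 0 -> exists y, x = a ^+ j * y].
Proof.
elim: j => [|j [e [ee Je ea aje eK]]].
  exists 0; split; rewrite ?mulr0 ?mul0r//; last by move=> x _ _; exists x; rewrite mul1r.
  have [r [Jr _ _]] := kernel_generator; exact: (rdi0 Jfin Jr).
(* r projects onto N(a), rho onto what is left of N(a) after the strip e *)
have [s asa] := left_invertible_pow_regular Jfin j.+1 ba.
have [r [Jr ar rx]] := kernel_generator.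
pose f := 1 - e.
have fe : f * e = 0 by rewrite mulrBl mul1r ee subrr.
have ef : e * f = 0 by rewrite mulrBr mulr1 ee subrr.
have ff : f * f = f by rewrite {2}/f mulrBr mulr1 fe subr0.
have fa : f * a = a * f by rewrite mulrBl mul1r ea mulrBr mulr1.
have fai i : f * a ^+ i = a ^+ i * f by apply: commrX.
have eai i : e * a ^+ i = a ^+ i * e by apply: commrX.
pose rho := f * r.
have arho : a * rho = 0 by rewrite mulrA -fa -mulrA ar mulr0.
have frho : f * rho = rho by rewrite mulrA ff.
have [|y rhoy] := eK _ arho; first by rewrite mulrA ef mul0r.
pose g := a ^+ j.+1 * s.
have [|z0 xz0] := rdi_regular Jfin (x := (1 - g) * rho); first by do 2!apply: JMl.
have rhov v : a * v = 0 -> e * v = 0 -> rho * v = v.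
  by move=> av ev; rewrite /rho -mulrA rx// mulrBl mul1r ev subr0.
have Jrho : J rho by apply: JMl.
clearbody f rho => {rx ar Jr r}.
have [x xE] : exists x, x = (1 - g) * rho by exists ((1 - g) * rho).
rewrite -xE in xz0.
have Jx : J x by rewrite xE; apply: JMl.
have [z zE] : exists u, u = z0 * x * z0 by eexists.
have xzx : x * z * x = x by rewrite zE !mulrA -xz0 -xz0.
have zxz : z * x * z * x = z * x by rewrite -!mulrA [x * (z * x)]mulrA xzx.
have Jz : J z by rewrite zE; apply: JMr; apply: JMl.
(* psi detects N(a) outside R(a^(j+1)); w takes the ends of chains, selected by
   psi, to the heads of these chains *)
have [psi psiE] : exists u, u = z * (1 - g) * f by eexists.
have psirho : psi * rho = z * x by rewrite psiE -!mulrA frho xE.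
have g1 : (1 - g) * a ^+ j.+1 = 0 by rewrite mulrBl mul1r -asa subrr.
have psia : psi * a ^+ j.+1 = 0.
  by rewrite psiE -mulrA fai mulrA -(mulrA z) g1 mulr0 mul0r.
have psie : psi * e = 0 by rewrite psiE -mulrA fe mulr0.
have psif : psi * f = psi by rewrite psiE -mulrA ff.
have [w wE] : exists u, u = f * y * psi by eexists.
have ajw : a ^+ j * w = rho * psi.
  by rewrite wE mulrA mulrA -fai -(mulrA f) -rhoy frho.
have aSjw : a ^+ j.+1 * w = 0 by rewrite exprS -mulrA ajw mulrA arho mul0r.
pose E := \sum_(i < j.+1) a ^+ i * w * a ^+ (j - i).
have JE : J E.
  rewrite /E; elim/big_ind: _ => [|u v|i _]; [|exact: JD|].
    exact: (rdi0 Jfin Jx).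
  by apply: JMr; apply: JMl; rewrite wE; apply: JMl; rewrite psiE; do 2!apply: JMr.
(* the sums telescope: a^(j+1) w = 0 = w a^(j+1) *)
have aE : a * E = E * a.
  have waS : w * a ^+ j * a = 0 by rewrite -mulrA -exprSr wE -mulrA psia mulr0.
  rewrite /E mulr_sumr mulr_suml big_ord_recr big_ord_recl /= addrC.
  rewrite subn0 mul1r waS subnn mulr1 mulrA -exprS aSjw; congr (_ + _).
  apply: eq_bigr => i _; rewrite /bump /= add1n !mulrA -exprS.
  by rewrite -[RHS]mulrA -exprSr subnSK.
have [|D ED] := drazin_exists Jfin (x := E) (n := 1); first by rewrite expr1.
have aD := drazin_comm ED aE.
have [EDC DED [m Em]] := ED.
have ew : e * w = 0 by rewrite wE !mulrA ef !mul0r.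
have we : w * e = 0 by rewrite wE -mulrA psie mulr0.
have eE : e * E = 0.
  by rewrite mulr_sumr big1// => i _; rewrite !mulrA eai -(mulrA _ e w) ew mulr0 mul0r.
have Ee : E * e = 0.
  by rewrite mulr_suml big1// => i _; rewrite -!mulrA -eai (mulrA w) we mul0r mulr0.
have [E1 E1E] : exists u, u = E * D by eexists.
have E1E1 : E1 * E1 = E1 by rewrite E1E -mulrA (mulrA D) DED.
have eE1 : e * E1 = 0 by rewrite E1E mulrA eE mul0r.
have E1e : E1 * e = 0 by rewrite E1E EDC -mulrA Ee mulr0.
exists (e + E1); split.
- by rewrite mulrDl !mulrDr ee eE1 E1e E1E1 addr0 add0r.
- by apply: JD => //; rewrite E1E; apply: JMr.
- by rewrite mulrDl mulrDr ea E1E (mulrA a) aE -!mulrA aD.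
- rewrite mulrDr {1}exprS -mulrA aje mulr0 add0r E1E mulrA.
  rewrite [_ * E]mulr_sumr big1 ?mul0r// => i _.
  by rewrite !mulrA -exprD addnC exprD -(mulrA (a ^+ i)) aSjw mulr0 mul0r.
- have Ev v : a * v = 0 -> e * v = 0 -> E * v = rho * (z * (x * v)).
    move=> av ev; rewrite mulr_suml big_ord_recr /= subnn mulr1 ajw big1 ?add0r => [|i _].
      by rewrite -[in LHS](rhov v)// -mulrA (mulrA psi) psirho !mulrA.
    by rewrite -(subnSK (ltn_ord i)) exprSr -!mulrA av !mulr0.
  have xv v : a * v = 0 -> e * v = 0 -> x * v = (1 - g) * v.
    by move=> av ev; rewrite xE -mulrA rhov.
  move=> v av ev.
  have e1v : e * v = 0.
    have : e * ((e + E1) * v) = 0 by rewrite ev mulr0.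
    by rewrite mulrA mulrDr ee eE1 addr0.
  have E1v : E1 * v = 0 by move: ev; rewrite mulrDl e1v add0r.
  have EnEv n : E ^+ n.+1 * v = E * v.
    elim: n => [|n IH]; first by rewrite expr1.
    have aEv : a * (E * v) = 0 by rewrite mulrA aE -mulrA av mulr0.
    have eEv : e * (E * v) = 0 by rewrite mulrA eE mul0r.
    rewrite exprS -mulrA IH (Ev (E * v))// xv// Ev// (mulrA (1 - g)) -xE.
    have xzxv : x * (z * (x * v)) = x * v by rewrite !mulrA xzx.
    by rewrite xzxv.
  have Ev0 : E * v = 0.
    by rewrite -(EnEv m) exprS -Em -E1E -!mulrA E1v !mulr0.
  exists (s * v); rewrite mulrA -/g; apply/esym/eqP; rewrite -subr_eq0.
  rewrite -opprB oppr_eq0 -[X in X - _]mul1r -mulrBl -xv//.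
  by rewrite -[x]xzx -!mulrA {1}xE -(mulrA (1 - g)) -Ev// Ev0 mulr0.
Qed.
End Kato.

(** Extending t by the identity on R(p) turns left invertibility on a corner into
left invertibility in the whole ring. *)
Lemma corner_left_invertible (t b p : A) :
    p * p = p -> p * t * (1 - p) = 0 -> J (b * t - (1 - p)) ->
  J ((b * (1 - p) + p) * (t * (1 - p) + p) - 1).
Proof.
move=> pp; have [n nE] : exists u, u = 1 - p by eexists.
rewrite -nE => ptn bt.
have pn : p * n = 0 by rewrite nE mulrBr mulr1 pp subrr.
have np : n * p = 0 by rewrite nE mulrBl mul1r pp subrr.
have nn : n * n = n by rewrite {2}nE mulrBr mulr1 np subr0.
have ntn : n * (t * n) = t * n by rewrite {1}nE mulrBl mul1r mulrA ptn subr0.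
have -> : (b * n + p) * (t * n + p) = b * (t * n) + p.
  by rewrite mulrDl !mulrDr (mulrA p) ptn pp add0r -!mulrA np mulr0 addr0 ntn.
have -> : b * (t * n) + p - 1 = (b * t - n) * n.
  by rewrite mulrBl nn -mulrA -addrA; congr (_ + _); rewrite nE opprB.
exact: JMr.
Qed.

(** The strips of the restriction of t to R(1 - p) are moved to R(p).  Strips of
length i raise the exponent of nilpotency from k + 1 to at most i + k + 1.
This would be circular, a larger exponent calling for longer strips, were i not
chosen at the start of an interval of length k + 1 on which the intersections
of N(a) with R(a^i) are constant. *)
Lemma kato_reduction (t b p : A) k :
    p * p = p -> p * t * (1 - p) = 0 -> p * t ^+ k = 0 ->
    J (t * p - p * t) -> J (b * t - (1 - p)) ->
  exists q m, [/\ q * q = q, q * t * (1 - q) = 0, q * t ^+ m.+1 = 0,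
    J (t * q - q * t) /\ J (b * t - (1 - q)) &
    forall x, t * x = 0 -> q * x = 0 -> exists y, x = (t * (1 - q)) ^+ m.+1 * y].
Proof.
move=> pp ptn ptk tp bt.
have J0 : J 0 by exact: (rdi0 Jfin tp).
have J00 a : J (a - a) by rewrite subrr.
have ptSk : p * t ^+ k.+1 = 0 by rewrite exprSr mulrA ptk mul0r.
have [n nE] : exists u, u = 1 - p by eexists.
rewrite -nE in ptn bt *.
have pn : p * n = 0 by rewrite nE mulrBr mulr1 pp subrr.
have np : n * p = 0 by rewrite nE mulrBl mul1r pp subrr.
have nn : n * n = n by rewrite {2}nE mulrBr mulr1 np subr0.
have [c cE] : exists u, u = t * n by eexists.
have pc : p * c = 0 by rewrite cE mulrA.
have cp : c * p = 0 by rewrite cE -mulrA np mulr0.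
pose a := c + p.
have ba : J ((b * n + p) * a - 1).
  by rewrite /a cE nE; apply: corner_left_invertible => //; rewrite -nE.
have [i ai] := kernel_cap_power_stable ba k.+1.
have [e [ee Je ea aie eK]] := kato_strip ba i.
have ap : a * p = p by rewrite mulrDl cp pp add0r.
have pa : p * a = p by rewrite mulrDr pc pp add0r.
have aip j : a ^+ j * p = p by elim: j => [|j IH]; rewrite ?mul1r// exprSr -mulrA ap.
have pai j : p * a ^+ j = p by elim: j => [|j IH]; rewrite ?mulr1// exprS mulrA pa.
have eai j : e * a ^+ j = a ^+ j * e by apply: commrX.
have ep : e * p = 0 by rewrite -(aip i) mulrA eai aie mul0r.
have pe : p * e = 0 by rewrite -(pai i) -mulrA aie mulr0.
have ec : e * c = a * e by rewrite -ea mulrDr ep addr0.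
have [q qE] : exists u, u = p + e by eexists.
have qq : q * q = q by rewrite qE mulrDl !mulrDr pp pe ep ee addr0 add0r.
have n1q : 1 - q = n * (1 - e).
  by rewrite nE mulrBl mul1r mulrBr mulr1 pe subr0 qE opprD addrA addrAC.
have etk j : e * t ^+ (j + k.+1) = a ^+ j * e * t ^+ k.+1.
  elim: j => [|j IH]; first by rewrite mul1r.
  have et : e * t = e * t * p + a * e.
    by rewrite -ec cE nE mulrA mulrBr mulr1 addrC subrK.
  rewrite addSn exprS mulrA et mulrDl -!mulrA IH.
  by rewrite addnC exprD (mulrA p) ptSk mul0r !mulr0 add0r (exprS a) !mulrA.
have qt1 : q * t * (1 - q) = 0.
  rewrite qE mulrDl mulrDl -qE n1q (mulrA (p * t)) ptn mul0r add0r.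
  rewrite -mulrA (mulrA t) -cE mulrA ec -mulrA mulrBr mulr1 ee subrr mulr0 //.
have qp : J (q - p) by rewrite qE addrAC subrr add0r.
exists q, (i + k)%N; split=> //.
- by rewrite -addnS qE mulrDl etk aie mul0r addr0 addnC exprD mulrA ptSk mul0r.
- split.
    apply: eqT (_ : J (t * p - q * t)); first exact: eqM.
    by apply: eqT tp _; apply: eqM => //; apply: eqC.
  apply: eqT bt _; rewrite nE opprB addrC subrKA; exact: qp.
- move=> x tx qx.
  have px : p * x = 0 by rewrite -[p]addr0 -pe -{1}pp -mulrDr -qE -mulrA qx mulr0.
  have ex : e * x = 0 by move: qx; rewrite qE mulrDl px add0r.
  have ax : a * x = 0.
    by rewrite mulrDl px addr0 cE -mulrA nE mulrBl mul1r px subr0.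
  have [y0 xy0] := eK _ ax ex.
  have [y xy] := ai _ _ ax xy0.
  have caz j z : q * z = 0 -> a ^+ j * z = (t * (1 - q)) ^+ j * z.
    elim: j z => [|j IH] z qz //.
    have pz : p * z = 0 by rewrite -[p]addr0 -pe -{1}pp -mulrDr -qE -mulrA qz mulr0.
    have az : a * z = t * (1 - q) * z.
      rewrite mulrDl pz addr0 cE -!mulrA; congr (t * _).
      by rewrite nE !mulrBl pz qz.
    rewrite !exprSr -[LHS]mulrA az IH; first by rewrite !mulrA.
    by rewrite !mulrA qt1 mul0r.
  exists ((1 - q) * y); rewrite -addnS.
  have -> : x = (1 - q) * x by rewrite mulrBl mul1r qx subr0.
  rewrite {1}xy -caz; last by rewrite mulrA mulrBr mulr1 qq subrr mul0r.
  rewrite !mulrA; congr (_ * _); apply: commrX.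
  rewrite /GRing.comm mulrBl mulrBr mul1r mulr1; congr (_ - _).
  by rewrite qE [LHS]mulrDl [RHS]mulrDr ea pa ap.
Qed.

(** A finite Neumann series solves the Sylvester equation h - l h r = g. *)
Lemma sylvester_sum (l g r : A) k : l ^+ k * g * r ^+ k = 0 ->
  let h := \sum_(i < k) l ^+ i * g * r ^+ i in h = g + l * h * r.
Proof.
move=> lgr /=.
have lhr : \sum_(i < k) l ^+ i * g * r ^+ i = \sum_(i < k.+1) l ^+ i * g * r ^+ i.
  by rewrite big_ord_recr /= lgr addr0.
rewrite [LHS]lhr big_ord_recl /= mul1r mulr1; congr (_ + _).
rewrite mulr_sumr mulr_suml; apply: eq_bigr => i _.
by rewrite /bump /= add1n exprS exprSr !mulrA.
Qed.

(** In this section t = m + f + c is a lower triangular element: m acts on R(p), c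
acts on R(n), and f maps R(p) to R(n). *)
Section Split.
Variables (p n m f c s : A) (k : nat).
Hypotheses (pp : p * p = p) (nE : n = 1 - p).
Hypotheses (pm : p * m = m) (mp : m * p = m) (mk0 : m ^+ k.+1 = 0).
Hypotheses (nf : n * f = f) (fp : f * p = f) (Jf : J f).
Hypotheses (nc : n * c = c) (cn : c * n = c).
Hypotheses (csc : c * s * c = c) (sf : s * f = 0).
Hypotheses (ns : n * s = s) (sn : s * n = s).
Hypothesis kato : forall x, c * x = 0 -> n * x = x -> exists y, x = c ^+ k.+1 * y.

Let pn : p * n = 0. Proof. by rewrite nE mulrBr mulr1 pp subrr. Qed.
Let np : n * p = 0. Proof. by rewrite nE mulrBl mul1r pp subrr. Qed.
Let nn : n * n = n. Proof. by rewrite {2}nE mulrBr mulr1 np subr0. Qed.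

(** The element n - s c projects onto N(c).  Inside R(c^(k+1)) the generalized
inverse s walks back along the chains of c: s c^(j+1) u - c^j u is in N(c),
hence again in R(c^(k+1)). *)
Lemma generalized_inverse_kernel_chain i : (i <= k.+1)%N ->
  exists u, n * u = u /\ s ^+ i * (n - s * c) = c ^+ (k.+1 - i) * u.
Proof.
elim: i => [|i IH] ik.
  have [||y ry] := @kato (n - s * c).
  - by rewrite mulrBr cn mulrA csc subrr.
  - by rewrite mulrBr nn mulrA ns.
  exists (n * y); rewrite mulrA nn subn0 mul1r; split=> //.
  by rewrite mulrA exprSr -[_ * c * n]mulrA cn -exprSr.
have [u [nu su]] := IH (ltnW ik).
rewrite exprS -mulrA su; set j := (k.+1 - i.+1)%N.
have -> : (k.+1 - i = j.+1)%N by rewrite /j -subSn.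
have ncj v : n * v = v -> n * (c ^+ j * v) = c ^+ j * v.
  by case: (j) => [|l] nv; rewrite ?mul1r// exprS !mulrA nc.
have cdj : c * (s * (c ^+ j.+1 * u) - c ^+ j * u) = 0.
  by rewrite mulrBr exprS !mulrA csc subrr.
have [|y dy] := kato cdj; first by rewrite mulrBr mulrA ns ncj.
exists (u + c ^+ (k.+1 - j) * y); split.
  rewrite mulrDr nu; congr (_ + _).
  have -> : (k.+1 - j = (k - j).+1)%N by rewrite subSn// /j subSS leq_subr.
  by rewrite exprS !mulrA nc.
rewrite mulrDr (mulrA (c ^+ j)) -exprD subnKC -?dy; last exact: leq_subr.
by rewrite addrC subrK.
Qed.

(** Let W be the subspace of R(p) on which all f m^i vanish, w the projection onto
W and v = p - w.  W is invariant and t is nilpotent on it.  Modulo W, t acts on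
R(n) + R(v) as z + c, with z its restriction to R(v), and l inverts z + c on
the left up to N(c).  Let G be the coupling from R(v) back to W.  The element
H l, with H = - G + m w H l, solves the equation that makes w + H l commute
with t, except for an obstruction on N(c).  There l acts as s and keeps within
R(n), where G vanishes. *)
Lemma split_triangular : exists E, [/\ E * E = E, E * (m + f + c) = (m + f + c) * E,
  (m + f + c) ^+ k.+1 * E = 0 & J (E - p)].
Proof.
have J0 : J 0 by exact: (rdi0 Jfin Jf).
have [|v0 [y0 [v0v0 Jv0 xv0 v0E]]] := left_ideal_gen (x := fun i => f * m ^+ i) k.+1.
  by move=> i; apply: JMr.
have fmip i : f * m ^+ i * p = f * m ^+ i.
  by case: i => [|i]; rewrite ?mulr1// exprSr -!mulrA mp.
have v0p : v0 * p = v0.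
  by rewrite v0E mulr_suml; apply: eq_bigr => i _; rewrite -mulrA fmip.
have [v vE] : exists u, u = p * v0 by eexists.
have pv : p * v = v by rewrite vE mulrA pp.
have vp : v * p = v by rewrite vE -mulrA v0p.
have vv : v * v = v by rewrite {2}vE mulrA vp vE -mulrA v0v0.
have Jv : J v by rewrite vE; apply: JMl.
have fmiv i : f * m ^+ i * v = f * m ^+ i.
  have [ik|ik] := ltnP i k.+1; first by rewrite vE mulrA fmip xv0.
  by rewrite -(subnKC ik) exprD mk0 mul0r mulr0 mul0r.
have fv : f * v = f by have := fmiv 0%N; rewrite mulr1.
have vsum : v = \sum_(i < k.+1) p * y0 i * (f * m ^+ i).
  by rewrite vE v0E mulr_sumr; apply: eq_bigr => i _; rewrite mulrA.
have vn : v * n = 0 by rewrite -vp -mulrA pn mulr0.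
have nv : n * v = 0 by rewrite -pv mulrA np mul0r.
have vm : v * m * v = v * m.
  rewrite {1 3}vsum !mulr_suml; apply: eq_bigr => i _.
  by rewrite -!(mulrA (p * y0 i)) -(mulrA f (m ^+ i) m) -exprSr fmiv.
have vf : v * f = 0 by rewrite -nf mulrA vn mul0r.
have vc : v * c = 0 by rewrite -nc mulrA vn mul0r.
have vs : v * s = 0 by rewrite -ns mulrA vn mul0r.
have sv : s * v = 0 by rewrite -sn -mulrA nv mulr0.
have cv : c * v = 0 by rewrite -cn -mulrA nv mulr0.
have [w wE] : exists u, u = p - v by eexists.
have ww : w * w = w by rewrite wE mulrBl !mulrBr pp pv vp vv subrr subr0.
have wv : w * v = 0 by rewrite wE mulrBl pv vv subrr.
have vw : v * w = 0 by rewrite wE mulrBr vp vv subrr.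
have fw : f * w = 0 by rewrite wE mulrBr fp fv subrr.
have nw : n * w = 0 by rewrite wE mulrBr np nv subr0.
have wn : w * n = 0 by rewrite wE mulrBl pn vn subr0.
have wf : w * f = 0 by rewrite -nf mulrA wn mul0r.
have wc : w * c = 0 by rewrite -nc mulrA wn mul0r.
have cw : c * w = 0 by rewrite -cn -mulrA nw mulr0.
have vmw : v * m * w = 0 by rewrite -vm -mulrA vw mulr0.
have wmw : w * m * w = m * w.
  have -> : w * m = m - v * m by rewrite wE mulrBl pm.
  by rewrite mulrBl vmw subr0.
have [G GE] : exists u, u = w * m * v by eexists.
have JG : J G by rewrite GE; apply: JMl.
have wm : w * m = m * w + G.
  by rewrite -wmw GE -mulrDr wE subrK -mulrA mp.
(* z is injective on R(v): a vector of R(v) on which f and v m vanish is killed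
   by all f m^i *)
have [z zE] : exists u, u = f + v * m by eexists.
have [h hE] : exists u, u = n - c * s by eexists.
have hf : h * f = f by rewrite hE mulrBl nf -mulrA sf mulr0 subr0.
have hv : h * v = 0 by rewrite hE mulrBl nv -mulrA sv mulr0 subr0.
have hc : h * c = 0 by rewrite hE mulrBl nc csc subrr.
have hz : h * z = f by rewrite zE mulrDr hf mulrA hv mul0r addr0.
have vz : v * z = v * m by rewrite zE mulrDr vf add0r mulrA vv.
have [l0 l0z] : exists l0, l0 * z = v.
  exists (\sum_(i < k.+1) p * y0 i * (if val i is j.+1 then f * m ^+ j * v else h)).
  rewrite mulr_suml [RHS]vsum; apply: eq_bigr => -[[|i] ik] _ /=.
    by rewrite -mulrA hz mulr1.
  by rewrite -(mulrA _ _ z) -(mulrA (f * _)) vz (mulrA (f * _) v) fmiv exprSr (mulrA f).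
have [l lE] : exists u, u = s + v * (l0 * (h + v)) by eexists.
have lc : l * c = s * c.
  by rewrite lE mulrDl -!mulrA (mulrDl h v c) hc vc addr0 !mulr0 addr0.
have lz : l * z = v.
  rewrite lE mulrDl -!mulrA (mulrDl h v z) hz vz -zE l0z vv.
  by rewrite zE mulrDr sf mulrA sv mul0r addr0 add0r.
have lir i : (i <= k.+1)%N -> l ^+ i * (n - s * c) = s ^+ i * (n - s * c).
  elim: i => [|i IH] ik; first by rewrite !mul1r.
  rewrite exprS -mulrA IH ?(ltnW ik)//.
  have [u [nu su]] := generalized_inverse_kernel_chain (ltnW ik).
  by rewrite exprS -[RHS]mulrA su subSn// exprS -!mulrA mulrA lc -mulrA.
have vlir i : (i <= k.+1)%N -> v * (l ^+ i * (n - s * c)) = 0.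
  move=> ik; rewrite lir//; case: i {ik} => [|i].
    by rewrite mul1r mulrBr vn mulrA vs mul0r subrr.
  by rewrite exprS !mulrA vs !mul0r.
have mwi i : (m * w) ^+ i.+1 = m ^+ i.+1 * w.
  elim: i => [|i IH] //.
  by rewrite exprSr IH -mulrA (mulrA w) wmw mulrA -exprSr.
have mwk0 : (m * w) ^+ k.+1 = 0 by rewrite mwi mk0 mul0r.
pose H := \sum_(i < k.+1) (m * w) ^+ i * (- G) * l ^+ i.
have HE : H = - G + m * w * H * l.
  by apply: sylvester_sum; rewrite mwk0 !mul0r.
have JH : J H.
  rewrite /H; elim/big_ind: _ => [//|u u'|i _]; first exact: JD.
  by apply: JMr; apply: JMl; apply: JN.
(* the obstruction on N(c) vanishes *)
have Hr : H * (n - s * c) = 0.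
  rewrite mulr_suml big1// => i _.
  by rewrite -(mulrA _ (l ^+ i)) GE mulrN mulNr -!mulrA vlir ?mulr0 ?oppr0// ltnW.
have wH : w * H = H.
  rewrite mulr_sumr; apply: eq_bigr => i _; rewrite !mulrA; congr (_ * _).
  have wG : w * G = G by rewrite GE !mulrA ww.
  case: (nat_of_ord i) => [|j]; first by rewrite !mul1r mulr1 mulrN wG.
  by rewrite exprS !mulrA wmw.
clearbody H.
have lw : l * w = 0.
  rewrite lE mulrDl -sn -!mulrA nw mulr0 add0r (mulrDl h) hE mulrBl nw -!mulrA.
  by rewrite -sn -mulrA nw vw !(mulr0, subr0, addr0).
have Hw : H * w = 0.
  by rewrite HE mulrDl mulNr GE -!mulrA vw lw !mulr0 oppr0 addr0.
have [t tE] : exists u, u = m + f + c by eexists.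
rewrite -tE.
have tw : t * w = m * w by rewrite tE !mulrDl fw cw !addr0.
have wt : w * t = m * w + G by rewrite tE !mulrDr wf wc !addr0.
have lm : l * m = l * (v * m).
  have -> : v * m = m - w * m by rewrite wE mulrBl pm subKr.
  by rewrite mulrBr [l * (w * m)]mulrA lw mul0r subr0.
have lt : l * t = v + s * c.
  by rewrite tE !mulrDr lm -mulrDr [v * m + f]addrC -zE lz lc.
have Hlt : H * (l * t) = H.
  rewrite lt mulrDr; have /subr0_eq <- : H * n - H * (s * c) = 0 by rewrite -mulrBr.
  have -> : v = 1 - n - w by rewrite nE wE subKr subKr.
  by rewrite !mulrBr Hw subr0 mulr1 subrK.
have [E EE] : exists u, u = w + H * l by eexists.
have lH : l * H = 0 by rewrite -wH mulrA lw mul0r.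
have wEE : w * E = E by rewrite EE mulrDr ww mulrA wH.
have tE' x : w * x = x -> t * x = m * x /\ w * (m * x) = m * x.
  by move=> wx; rewrite -wx !mulrA tw wmw.
exists E; split.
- by rewrite {1}EE mulrDl wEE -mulrA {2}EE mulrDr lw mulrA lH mul0r addr0 mulr0 addr0.
- have [-> _] := tE' E wEE.
  by rewrite EE mulrDl -[H * l * t]mulrA Hlt wt mulrDr {1}HE addrA addrK -(mulrA m w) wH !mulrA.
- have txj j x : w * x = x -> t ^+ j * x = m ^+ j * x.
    elim: j x => [|j IH] x wx //; have [tx wmx] := tE' x wx.
    by rewrite !exprSr -!mulrA tx IH.
  by rewrite txj// mk0 mul0r.
- by rewrite EE wE addrAC [p - v - p]addrAC subrr sub0r; apply: JD; [apply: JN|apply: JMr].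
Qed.
End Split.

(** Conjugation by 1 + Q, with Q = s H and H = f + s H m, replaces the coupling f
by (1 - c s) H, which takes values in a complement of R(c). *)
Lemma splitting_lower_triangular (t b p : A) k :
    p * p = p -> p * t * (1 - p) = 0 -> p * t ^+ k.+1 = 0 ->
    J (t * p - p * t) -> J (b * t - (1 - p)) ->
    (forall x, t * x = 0 -> p * x = 0 -> exists y, x = (t * (1 - p)) ^+ k.+1 * y) ->
  exists E, [/\ E * E = E, E * t = t * E, t ^+ k.+1 * E = 0 & J (E - p)].
Proof.
move=> pp ptn ptk tp bt kato.
have ba := corner_left_invertible pp ptn bt.
have [n nE] : exists u, u = 1 - p by eexists.
rewrite -nE in ptn bt kato ba.
have pn : p * n = 0 by rewrite nE mulrBr mulr1 pp subrr.
have np : n * p = 0 by rewrite nE mulrBl mul1r pp subrr.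
have nn : n * n = n by rewrite {2}nE mulrBr mulr1 np subr0.
have [c cE] : exists u, u = t * n by eexists.
rewrite -cE in ba.
have pc : p * c = 0 by rewrite cE mulrA.
have nc : n * c = c by rewrite nE mulrBl mul1r pc subr0.
have cn : c * n = c by rewrite cE -mulrA nn.
have cp : c * p = 0 by rewrite cE -mulrA np mulr0.
have [s0 s0E _] := inner_inverse ba.
have cs0c : c * s0 * c = c.
  have na : n * (c + p) = c by rewrite mulrDr np nc addr0.
  have an : (c + p) * n = c by rewrite mulrDl pn cn addr0.
  have : n * (c + p) * s0 * ((c + p) * n) = n * ((c + p) * s0 * (c + p)) * n.
    by rewrite !mulrA.
  by rewrite -s0E na an cn.
have [s1 s1E] : exists u, u = n * s0 * n by eexists.
have cs1c : c * s1 * c = c by rewrite s1E !mulrA cn -(mulrA _ n) nc.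
have s1cs1 : s1 * c * s1 * c = s1 * c by rewrite -!mulrA (mulrA c) cs1c.
have [s sE] : exists u, u = s1 * c * s1 by eexists.
have csc : c * s * c = c by rewrite sE !mulrA cs1c cs1c.
have scs : s * c * s = s by rewrite sE !mulrA !s1cs1.
have ns : n * s = s by rewrite sE s1E !mulrA nn.
have sn : s * n = s by rewrite sE s1E -!mulrA nn.
have [m mE] : exists u, u = p * t by eexists.
have pm : p * m = m by rewrite mE mulrA pp.
have mp : m * p = m.
  by move: ptn; rewrite nE mulrBr mulr1 -mE => /subr0_eq.
have mX i : m ^+ i.+1 = p * t ^+ i.+1.
  elim: i => [|i IH]; first by rewrite !expr1.
  by rewrite exprS IH mulrA mp mE -mulrA -exprS.
have mk0 : m ^+ k.+1 = 0 by rewrite mX.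
have [f fE] : exists u, u = n * t * p by eexists.
have nf : n * f = f by rewrite fE !mulrA nn.
have fp : f * p = f by rewrite fE -!mulrA pp.
have Jf : J f.
  have -> : f = n * (t * p - p * t) by rewrite mulrBr (mulrA n p) np mul0r subr0 mulrA.
  exact: JMl.
have tE : t = m + f + c.
  have -> : m + f = t * p.
    by rewrite -mp mE fE -mulrDl -mulrDl nE subrKC mul1r.
  by rewrite cE nE mulrBr mulr1 subrKC.
pose H := \sum_(i < k.+1) s ^+ i * f * m ^+ i.
have HE : H = f + s * H * m by apply: sylvester_sum; rewrite mk0 mulr0.
have JH : J H.
  rewrite /H; elim/big_ind: _ => [|u u'|i _]; [exact: (rdi0 Jfin Jf)|exact: JD|].
  by apply: JMr; apply: JMl.
clearbody H.
have Hp : H * p = H by rewrite HE mulrDl fp -(mulrA _ m) mp.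
have nH : n * H = H by rewrite HE mulrDr nf !mulrA ns.
have Hs : H * s = 0 by rewrite -Hp -ns -!mulrA (mulrA p) pn mul0r mulr0.
have Hf : H * f = 0 by rewrite -Hp -nf -!mulrA (mulrA p) pn mul0r mulr0.
have Hc : H * c = 0 by rewrite -Hp -nc -!mulrA (mulrA p) pn mul0r mulr0.
have ms : m * s = 0 by rewrite -mp -ns -!mulrA (mulrA p) pn mul0r mulr0.
have [f1 f1E] : exists u, u = H - c * s * H by eexists.
have csf1 : c * s * f1 = 0 by rewrite f1E mulrBr !mulrA csc subrr.
have nf1 : n * f1 = f1 by rewrite f1E mulrBr nH !mulrA nc.
have f1p : f1 * p = f1 by rewrite f1E mulrBl Hp -!mulrA Hp.
have Jf1 : J f1 by rewrite f1E; apply: JB => //; apply: JMl.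
have sf1 : s * f1 = 0 by rewrite -scs -!mulrA (mulrA c) csf1 mulr0.
have kato' x : c * x = 0 -> n * x = x -> exists y, x = c ^+ k.+1 * y.
  move=> cx nx; rewrite cE; apply: kato.
    by rewrite -nx mulrA -cE.
  by rewrite -nx mulrA pn mul0r.
have [E1 [E1E1 E1t tE1 E1p]] :=
  split_triangular pp nE pm mp mk0 nf1 f1p Jf1 nc cn csc sf1 ns sn kato'.
have [t1 t1E] : exists u, u = m + f1 + c by eexists.
rewrite -t1E in E1t tE1.
have [Q QE] : exists u, u = s * H by eexists.
have QQ : Q * Q = 0 by rewrite QE -mulrA (mulrA H) Hs mul0r mulr0.
have qQ : (1 - Q) * (1 + Q) = 1.
  by rewrite mulrBl mul1r mulrDr mulr1 QQ addr0 addrK.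
have Qq : (1 + Q) * (1 - Q) = 1.
  by rewrite mulrBr mulr1 mulrDl mul1r QQ addr0 addrK.
have JQ : J Q by rewrite QE; apply: JMl.
have Qt : (1 + Q) * t = t1 * (1 + Q).
  have t1Q : t1 * Q = c * s * H.
    have f1s : f1 * s = 0 by rewrite f1E mulrBl Hs -!mulrA Hs !mulr0 subr0.
    by rewrite t1E QE !mulrA !mulrDl ms f1s !mul0r !add0r.
  rewrite mulrDl mul1r mulrDr mulr1 t1Q t1E f1E {1}tE.
  have -> : Q * t = s * H * m by rewrite QE tE !mulrDr -!mulrA Hf Hc mulr0 !addr0.
  by rewrite [LHS]addrAC -(addrA m f) -HE [RHS]addrAC (addrA m) subrK.
have tQ : t * (1 - Q) = (1 - Q) * t1.
  have -> : t * (1 - Q) = (1 - Q) * ((1 + Q) * t) * (1 - Q) by rewrite mulrA qQ mul1r.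
  by rewrite Qt -!mulrA Qq mulr1.
have Q1 : J (1 - Q - 1) by rewrite addrAC subrr sub0r; apply: JN.
have Q2 : J (1 + Q - 1) by rewrite addrAC subrr add0r.
exists ((1 - Q) * E1 * (1 + Q)); split.
- by rewrite -!mulrA (mulrA (1 + Q)) Qq mul1r (mulrA E1) E1E1.
- rewrite -[LHS]mulrA Qt [RHS]mulrA [t * (_ * E1)]mulrA tQ -!mulrA.
  by rewrite (mulrA E1) E1t -mulrA.
- have tX i : t ^+ i * (1 - Q) = (1 - Q) * t1 ^+ i.
    elim: i => [|i IH]; first by rewrite mul1r mulr1.
    by rewrite exprSr -mulrA tQ mulrA IH -mulrA -exprSr.
  by rewrite !mulrA tX -!mulrA (mulrA (t1 ^+ _)) tE1 mul0r mulr0.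
- by rewrite -[p]mul1r -[X in _ - X]mulr1; apply: (eqM _ Q2); apply: eqM.
Qed.

Theorem kato_type_splitting (P t b : A) r : P * P = P -> J (t * P - P * t) ->
    J (b * t + b * P - 1) -> J ((t * P) ^+ r) ->
  exists E b' k, [/\ E * E = E, E * t = t * E, t ^+ k * E = 0 & J (b' * t - (1 - E))].
Proof.
move=> PP tP bt nt.
have [p [b' [k [pp pk tp bp]]]] := nilpotent_corner PP tP bt nt.
have [q [qq qtn qtk tq bq]] := lower_triangular pp pk tp bp.
have [p' [m [pp' ptn ptm [tp' bp'] kato]]] := kato_reduction qq qtn qtk tq bq.
have [E [EE Et tE Ep]] := splitting_lower_triangular pp' ptn ptm tp' bp' kato.
exists E, b', m.+1; split=> //; apply: eqT bp' _.
by rewrite opprB addrC subrKA.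
Qed.

End Splitting.

(** * The ideal of finite rank operators *)

Section Dependence.
Variables (K : fieldType) (V : lmodType K).

Lemma linear_dependence n (v : 'I_n -> V) (w : nat -> V) :
  (forall i, lin_span v (w i)) ->
  exists c : 'I_n.+1 -> K, (exists i, c i != 0) /\ \sum_(i < n.+1) c i *: w i = 0.
Proof.
move=> /choice[d wd].
pose M := \matrix_(i < n.+1, j < n) d i j.
have : kermx M != 0.
  rewrite kermx_eq0 /row_free; apply/eqP => rM.
  by have := rank_leq_col M; rewrite rM ltnn.
move=> /matrix0Pn[i [j Mij]]; exists (fun j => kermx M i j); split; first by exists j.
under eq_bigr => k _ do rewrite wd scaler_sumr.
rewrite exchange_big big1//= => l _.
under eq_bigr => k _ do rewrite scalerA.
rewrite -scaler_suml; have /matrixP/(_ i l) := mulmx_ker M; rewrite !mxE => E.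
by rewrite -[RHS](scale0r (v l)) -[in RHS]E; congr (_ *: _); apply: eq_bigr => k _; rewrite !mxE.
Qed.

Lemma subspace_setZ (S : set V) a x : subspace_set S -> S x -> S (a *: x).
Proof. by move=> [S0 SD] Sx; rewrite -[_ *: _]addr0; apply: SD. Qed.
Lemma subspace_setD (S : set V) x y : subspace_set S -> S x -> S y -> S (x + y).
Proof. by move=> [S0 SD] Sx Sy; rewrite -[x]scale1r; apply: SD. Qed.

End Dependence.

Section FiniteRank.
Variables (K : numFieldType) (X : normedModType K).

Definition bounded_form (h : X -> K) :=
  scalar h /\ exists C, forall x, `|h x| <= C * `|x|.

Lemma bounded_formD a f g : bounded_form f -> bounded_form g ->
  bounded_form (fun x => f x + a * g x).
Proof.
move=> [lf [C fC]] [lg [D gD]]; split.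
  by move=> b x y; rewrite lf lg !mulrDr addrACA mulrCA.
exists (C + `|a| * D) => x; rewrite (le_trans (ler_normD _ _))// mulrDl lerD//.
by rewrite normrM -mulrA ler_wpM2l.
Qed.

Lemma bounded_form0 : bounded_form (fun=> 0).
Proof.
split; first by move=> a x y; rewrite mulr0 addr0.
by exists 0 => x; rewrite normr0 mul0r.
Qed.

Lemma bounded_form_sum n (a : 'I_n -> K) (f : 'I_n -> X -> K) :
  (forall i, bounded_form (f i)) -> bounded_form (fun x => \sum_(i < n) a i * f i x).
Proof.
elim: n a f => [|n IH] a f bf.
  have -> : (fun x => \sum_(i < 0) a i * f i x) = fun=> 0 by apply/funext => x; rewrite big_ord0.
  exact: bounded_form0.
have -> : (fun x => \sum_(i < n.+1) a i * f i x) =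
  fun x => \sum_(i < n) a (widen_ord (leqnSn n) i) * f (widen_ord (leqnSn n) i) x + a ord_max * f ord_max x.
  by apply/funext => x; rewrite big_ord_recr.
by apply: bounded_formD => //; apply: IH.
Qed.

Lemma finite_sum_op n (h : 'I_n -> X -> K) (v : 'I_n -> X) :
  (forall i, bounded_form (h i)) ->
  exists F : bop X, forall x, F x = \sum_(i < n) h i x *: v i.
Proof.
move=> hb; suff bF : (fun x => \sum_(i < n) h i x *: v i) \in @bounded_op K X.
  by exists (Bop bF).
apply/asboolP; split.
  move=> a x y; rewrite scaler_sumr -big_split /=; apply: eq_bigr => i _.
  by have [-> _] := hb i; rewrite scalerDl scalerA.
have [C hC] := choice (fun i => proj2 (hb i)).
exists (\sum_(i < n) C i * `|v i|) => x.
rewrite (le_trans (ler_norm_sum _ _ _))// mulr_suml ler_sum// => i _.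
by rewrite normrZ mulrAC ler_wpM2r.
Qed.

Hypothesis separating : forall x : X, x != 0 ->
  exists2 h, bounded_form h & h x = 1.

(** Induction on n.  The vector w is what v ord0 adds to the span of the others.
A form g with g w = 1, or g = 0 when w = 0, gives the coordinate along v ord0
after projecting the others away. *)
Lemma dual_coordinates n (v : 'I_n -> X) : exists h : 'I_n -> X -> K,
  (forall i, bounded_form (h i)) /\
  forall x, lin_span v x -> x = \sum_(i < n) h i x *: v i.
Proof.
suff [h [hb hv]] : exists h : 'I_n -> X -> K,
  (forall i, bounded_form (h i)) /\ forall j, v j = \sum_(i < n) h i (v j) *: v i.
  exists h; split=> // _ [c ->].
  have [F FE] := finite_sum_op v hb.
  rewrite -FE linear_sum; apply: eq_bigr => i _.
  by rewrite linearZ /= FE -hv.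
elim: n v => [|n IH] v; first by exists (fun _ _ => 0); split=> -[].
pose v' i := v (lift ord0 i); have [h [hb hv]] := IH v'.
pose w := v ord0 - \sum_(i < n) h i (v ord0) *: v' i.
have [g gb gw] : exists2 g, bounded_form g & w = g w *: w.
  have [->|w0] := eqVneq w 0; first by exists (fun=> 0); rewrite ?scaler0//; exact: bounded_form0.
  by have [g gb gw] := separating w0; exists g => //; rewrite gw scale1r.
pose h0 x := g x + -1 * \sum_(i < n) g (v' i) * h i x.
have h0b : bounded_form h0 by apply: bounded_formD => //; exact: bounded_form_sum.
have [lg _] := gb.
pose G : {scalar X} := HB.pack g (GRing.isLinear.Build K X K *%R g lg).
have h0E x : h0 x = g (x - \sum_(i < n) h i x *: v' i).
  rewrite /h0 mulN1r -[g (_ - _)]/(G _) linearB (linear_sum G) /=; congr (_ - _).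
  by apply: eq_bigr => i _; rewrite -[RHS]/(G _) linearZ mulrC.
exists (fun i => if unlift ord0 i is Some j then fun x => h j x + - h j (v ord0) * h0 x else h0).
split=> [i|j].
  by case: unliftP => [j _|_] //; exact: bounded_formD.
rewrite big_ord_recl unlift_none /=.
under eq_bigr => i _ do rewrite liftK.
case: (unliftP ord0 j) => [l ->|->]; last first.
  have -> : \sum_(i < n) (h i (v ord0) + - h i (v ord0) * h0 (v ord0)) *: v' i =
     (1 - h0 (v ord0)) *: \sum_(i < n) h i (v ord0) *: v' i.
    rewrite scaler_sumr; apply: eq_bigr => i _; rewrite scalerA mulrBl mul1r.
    by rewrite mulNr [h0 _ * _]mulrC.
  have /eqP := gw; rewrite -h0E {1}/w subr_eq scalerBl scale1r => /eqP {1}->.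
  by rewrite scalerBr addrAC addrA.
have h0v : h0 (v (lift ord0 l)) = 0.
  by rewrite h0E -[v (lift _ _)]/(v' l) -hv subrr -[g 0]/(G 0) linear0.
rewrite h0v scale0r add0r -[v (lift _ _)]/(v' l) {1}hv.
by apply: eq_bigr => i _; rewrite mulr0 addr0.
Qed.

(** Z sends the vectors that span R(F) back to preimages. *)
Lemma finite_rank_regular (F : bop X) : F \in (@finite_rank K X) ->
  exists Z : bop X, F = F * Z * F.
Proof.
move=> /asboolP[n [v Fv]]; have [h [hb hv]] := dual_coordinates v.
have /choice[u uE] : forall i, exists y, F y = v i.
  move=> i.
  have : range F (v i).
    rewrite Fv; exists (fun j => (j == i)%:R); rewrite (bigD1 i)//= eqxx scale1r.
    by rewrite big1 ?addr0// => j /negPf ->; rewrite scale0r.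
  by move=> [x _ <-]; exists x.
have [Z ZE] := finite_sum_op u hb.
exists Z; apply: bop_ext => x; rewrite !bopM ZE linear_sum.
rewrite [LHS]hv; last by rewrite -Fv; exists x.
by apply: eq_bigr => i _; rewrite linearZ /= uE.
Qed.

(** Otherwise there are x i (u i) outside R(x (i+1)) for all i.  Since the ranges
decrease, these vectors of R(x 0) are independent. *)
Lemma finite_rank_dccr (x : nat -> bop X) : x 0%N \in (@finite_rank K X) ->
  (forall i, exists w, x i.+1 = x i * w) -> exists i w, x i = x i.+1 * w.
Proof.
move=> x0 xS; apply: contrapT => /forallNP nx.
have sub i j : (i <= j)%N -> range (x j) `<=` range (x i).
  elim: j => [|j IH]; first by rewrite leqn0 => /eqP ->.
  rewrite leq_eqVlt => /orP[/eqP ->//|/IH]; apply: subset_trans.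
  by have [w ->] := xS j => _ [y _ <-]; exists (w y).
have xf i : x i \in (@finite_rank K X).
  by elim: i => [//|i IH]; have [w ->] := xS i; exact: finite_rankMr.
have /choice[u uE] : forall i, exists y, ~ range (x i.+1) (x i y).
  move=> i.
  apply: contrapT => /forallNP nr; apply: (nx i).
  have [z zE] := finite_rank_regular (xf i.+1).
  exists (z * x i); apply: bop_ext => y.
  have /contrapT[y' _ yy'] := nr y.
  by rewrite !bopM -yy'; exact: (congr1 (fun F : bop X => F y') zE).
have /asboolP[n [v xv]] := x0.
have [|c [[i0 ci0] cE]] := @linear_dependence _ _ n v (fun i => x i (u i)).
  by move=> i; rewrite -xv; apply: (sub 0%N i) => //; exists (u i).
case: (@arg_minnP _ i0 (fun i => c i != 0) (fun i => val i) ci0) => i ci imin.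
apply: (uE i); have sr := range_subspace (x i.+1).
have : range (x i.+1) (\sum_(j < n.+1 | j != i) c j *: x j (u j)).
  elim/big_ind: _ => [|y y'|j ji]; [by case: sr|exact: subspace_setD|].
  have [->|cj] := eqVneq (c j) 0; first by rewrite scale0r; case: sr.
  apply: subspace_setZ => //; apply: (sub i.+1 j); last by exists (u j).
  by rewrite ltn_neqAle imin// andbT eq_sym.
move: cE; rewrite (bigD1 i)//= => /eqP; rewrite addr_eq0 => /eqP E r.
have -> : x i (u i) = - (c i)^-1 *: \sum_(j < n.+1 | j != i) c j *: x j (u j).
  by rewrite scaleNr -scalerN -E scalerA mulVf// scale1r.
exact: (subspace_setZ _ sr r).
Qed.

(** Otherwise there are u i in N(x (i+1)) and not in N(x i) for all i.  Since the
kernels increase and x i factors through x 0, the vectors x 0 (u i) of R(x 0)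
are independent. *)
Lemma finite_rank_dccl (x : nat -> bop X) : x 0%N \in (@finite_rank K X) ->
  (forall i, exists w, x i.+1 = w * x i) -> exists i w, x i = w * x i.+1.
Proof.
move=> x0 xS; apply: contrapT => /forallNP nx.
have sub i j : (i <= j)%N -> exists t, x j = t * x i.
  elim: j => [|j IH]; first by rewrite leqn0 => /eqP ->; exists 1; rewrite mul1r.
  rewrite leq_eqVlt => /orP[/eqP ->|/IH[t tE]]; first by exists 1; rewrite mul1r.
  by have [w ->] := xS j; exists (w * t); rewrite tE mulrA.
have xf i : x i \in (@finite_rank K X).
  by elim: i => [//|i IH]; have [w ->] := xS i; exact: finite_rankMl.
have /choice[u uE] : forall i, exists y, x i.+1 y = 0 /\ x i y != 0.
  move=> i.
  apply: contrapT => /forallNP nr; apply: (nx i).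
  have [z zE] := finite_rank_regular (xf i.+1).
  exists (x i * z); apply: bop_ext => y.
  apply/eqP; rewrite -subr_eq0 -mulrA bopM -linearB; apply/negPn/negP => ne.
  apply: (nr (y - (z * x i.+1) y)); split=> //.
  by rewrite linearB -[X in _ - X]bopM mulrA -zE subrr.
have /asboolP[n [v xv]] := x0.
have [|c [[i0 ci0] cE]] := @linear_dependence _ _ n v (fun i => x 0%N (u i)).
  by move=> i; rewrite -xv; exists (u i).
case: (@arg_maxnP _ i0 (fun i => c i != 0) (fun i => val i) ci0) => i ci imax.
have [t tE] := sub 0%N i isT.
have : t (\sum_(j < n.+1) c j *: x 0%N (u j)) = 0 by rewrite cE linear0.
rewrite linear_sum (bigD1 i)//= big1 ?addr0 => [|j ji]; last first.
  have [->|cj] := eqVneq (c j) 0; first by rewrite scale0r linear0.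
  have jlti : (j < i)%N by rewrite ltn_neqAle ji; exact: imax.
  have [t' xt] := sub _ _ jlti.
  by rewrite linearZ /= -bopM -tE xt bopM (proj1 (uE j)) linear0 scaler0.
rewrite linearZ /= -bopM -tE => /eqP; rewrite scaler_eq0 (negPf ci) /=.
by rewrite (negPf (proj2 (uE i))).
Qed.

Lemma finite_rank_regular_dcc_ideal : @regular_dcc_ideal (bop X) (fun F => F \in (@finite_rank K X)).
Proof.
split.
- by move=> F G Ff Gf; apply: rpredB.
- by move=> F G; apply: finite_rankMl.
- by move=> F G; apply: finite_rankMr.
- exact: finite_rank_regular.
- exact: finite_rank_dccr.
- exact: finite_rank_dccl.
Qed.

End FiniteRank.

(** * The Hahn-Banach theorem *)

Section HahnBanach.
Variables (R : realType) (V : lmodType R) (N : V -> R).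
Hypothesis ND : forall x y, N (x + y) <= N x + N y.
Hypothesis NZ : forall a x, N (a *: x) = `|a| * N x.

(** Graphs of linear functionals on a subspace, bounded above by N.  Being
single-valued follows: if (0, r) is in G then so is (0, - r), and N 0 = 0. *)
Definition dominated_graph (G : set (V * R)) :=
  (forall a p q, G p -> G q -> G (a *: p.1 + q.1, a * p.2 + q.2)) /\
  (forall p, G p -> p.2 <= N p.1).

Let N0 : N 0 = 0.
Proof. by have := NZ 0 0; rewrite scale0r normr0 mul0r. Qed.

Let NN x : N (- x) = N x.
Proof. by rewrite -scaleN1r NZ normrN1 mul1r. Qed.

Let N_ge0 x : 0 <= N x.
Proof.
by have := ND x (- x); rewrite subrr N0 NN -mulr2n -mulr_natl pmulr_rge0.
Qed.

(** The numbers p.2 - N (p.1 - x1), for p in G, lie below all N (q.1 + x1) - q.2,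
for q in G.  Any value in between extends the functional to x1. *)
Lemma dominated_extension (G : set (V * R)) x1 p0 : G p0 -> dominated_graph G ->
  exists alpha, dominated_graph
    [set q | exists p c, G p /\ q = (p.1 + c *: x1, p.2 + c * alpha)].
Proof.
move=> Gp0 [GD GN].
pose S := [set p.2 - N (p.1 - x1) | p in G].
have ubS q : G q -> ubound S (N (q.1 + x1) - q.2).
  move=> Gq _ [p Gp <-].
  rewrite lerBrDr addrAC lerBlDr -[p.2]mul1r (le_trans (GN _ (GD 1 p q Gp Gq)))//=.
  rewrite scale1r (le_trans _ (ND _ _))// le_eqVlt; apply/orP; left; apply/eqP; congr N.
  by rewrite [RHS]addrACA subrr addr0 addrC.
have supS : has_sup S.
  by split; [exists (p0.2 - N (p0.1 - x1)), p0|exists (N (p0.1 + x1) - p0.2); exact: ubS].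
exists (sup S); split.
  move=> a _ _ [p [c [Gp ->]]] [q [d [Gq ->]]] /=.
  exists (a *: p.1 + q.1, a * p.2 + q.2), (a * c + d); split; first exact: GD.
  by rewrite /= scalerDr scalerDl scalerA mulrDr mulrDl mulrA (addrACA (a *: p.1)) (addrACA (a * p.2)).
move=> _ [p [c [Gp ->]]] /=.
have GZ a : G (a *: p.1, a * p.2).
  have G0 : G (0, 0).
    by have := GD (-1) p p Gp Gp; rewrite scaleN1r mulN1r !addNr.
  by have := GD a p (0, 0) Gp G0; rewrite /= !addr0.
have [c0|c0|->] := ltgtP c 0; last by rewrite scale0r mul0r !addr0; exact: GN.
  have nc0 : 0 < - c by rewrite oppr_gt0.
  have : S ((- c)^-1 * p.2 - N ((- c)^-1 *: p.1 - x1)).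
    by exists ((- c)^-1 *: p.1, (- c)^-1 * p.2) => //; exact: GZ.
  move=> /(ub_le_sup (proj2 supS)).
  rewrite -(ler_pM2l nc0) mulrBr mulrA divff ?gt_eqF// mul1r.
  rewrite -{1}[- c]gtr0_norm// -NZ scalerBr scalerA divff ?gt_eqF// scale1r scaleNr opprK.
  by rewrite mulNr lerBlDr addrC -lerBlDr opprK.
have : sup S <= N (c^-1 *: p.1 + x1) - c^-1 * p.2.
  apply: ge_sup; first exact: (proj1 supS).
  exact: (ubS _ (GZ c^-1)).
rewrite -(ler_pM2l c0) mulrBr mulrA divff ?gt_eqF// mul1r.
rewrite -{2}[c]gtr0_norm// -NZ scalerDr scalerA divff ?gt_eqF// scale1r.
by rewrite lerBrDr addrC.
Qed.

Theorem hahn_banach x0 : exists f : V -> R,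
  [/\ scalar f, f x0 = N x0 & forall x, `|f x| <= N x].
Proof.
pose P (G : set (V * R)) := G = set0 \/ dominated_graph G /\ G (x0, N x0).
(* the empty graph is admitted because it is the union of the empty chain *)
have [F FP totF|A [PA maxA]] := @Zorn_bigcup _ P.
  have [[B FB [b Bb]]|F0] := pselect (exists2 B, F B & B !=set0); last first.
    left; rewrite -subset0 => p [B FB Bp]; apply: F0; exists B => //; by exists p.
  right; split; last first.
    by exists B => //; have [B0|[]//] := FP _ FB; move: Bb; rewrite B0.
  split=> [a p q [C FC Cp] [D FD Dq]|p [C FC Cp]]; last first.
    by have [C0|[[_ CN] _]] := FP _ FC; [move: Cp; rewrite C0|exact: CN].
  have [CD|DC] := totF _ _ FC FD.
    exists D => //; have [D0|[[DD _] _]] := FP _ FD; first by move: Dq; rewrite D0.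
    by apply: DD => //; exact: CD.
  exists C => //; have [C0|[[CC _] _]] := FP _ FC; first by move: Cp; rewrite C0.
  by apply: CC => //; exact: DC.
have [[AD AN] Ax0] : dominated_graph A /\ A (x0, N x0).
  case: PA => [A0|//]; exfalso.
  apply: (maxA [set (c *: x0, c * N x0) | c in setT]).
    rewrite A0; split; first by move=> ?.
    by move=> /(_ (0 *: x0, 0 * N x0)); apply; exists 0.
  right; split; last by exists 1 => //; rewrite scale1r mul1r.
  split=> [a _ _ [c _ <-] [d _ <-]|_ [c _ <-]] /=.
    by exists (a * c + d) => //; rewrite scalerDl scalerA mulrDl mulrA.
  by rewrite NZ ler_wpM2r// ler_norm.
have /choice[f Af] : forall x, exists r, A (x, r).
  move=> x1; apply: contrapT => nx1.
  have [al Bd] := dominated_extension x1 Ax0 (conj AD AN).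
  have A00 : A (0, 0).
    by have := AD (-1) _ _ Ax0 Ax0; rewrite scaleN1r mulN1r !addNr.
  set B := [set _ | _] in Bd.
  have AB : A `<=` B.
    by move=> p Ap; exists p, 0; split=> //; rewrite scale0r mul0r !addr0; case: (p).
  apply: (maxA B).
    split=> // BA; apply: nx1; exists al; apply: BA.
    by exists (0, 0), 1; split=> //=; rewrite scale1r mul1r !add0r.
  by right; split=> //; exact: AB.
have Auniq x r s : A (x, r) -> A (x, s) -> r <= s.
  move=> Ar As; have := AN _ (AD (-1) _ _ As Ar).
  by rewrite /= scaleN1r addNr N0 mulN1r addrC subr_le0.
have fE x r : A (x, r) -> f x = r.
  by move=> Ar; apply/eqP; rewrite eq_le !(Auniq x).
have lf : scalar f by move=> a x y; apply: fE; exact: (AD a _ _ (Af x) (Af y)).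
exists f; split=> //; first exact: fE.
move=> x; rewrite ler_norml (AN _ (Af x)) andbT lerNl -NN.
apply: le_trans (AN _ (Af (- x))) => /=.
have := lf (-1) x 0; rewrite scaleN1r addr0 => ->.
have -> : f 0 = 0 by apply: fE; have := AD (-1) _ _ Ax0 Ax0; rewrite scaleN1r mulN1r !addNr.
by rewrite addr0 mulN1r.
Qed.

End HahnBanach.

(** * The closed graph theorem *)

Section ClosedGraph.
Variables (R : realType) (V W : completeNormedModType R) (f : {linear V -> W}).
Hypothesis closed_graph : forall x y,
  (forall e, 0 < e -> exists x', `|x - x'| < e /\ `|y - f x'| < e) -> f x = y.

Let A (n : nat) := [set x | `|f x| <= n%:R].

(** The sublevel sets of |f| cover V, so Baire's theorem applies. *)
Lemma sublevel_somewhere_dense : exists n x0 (r : R), 0 < r /\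
  ball x0 r `<=` closure (A n).
Proof.
have [n nd] : exists n, ~ dense (~` closure (A n)).
  apply: contrapT => /forallNP nd.
  have : dense (\bigcap_i (~` closure (A i))).
    apply: Baire => i; split; last exact: contrapT (nd i).
    by apply: closed_openC; exact: closed_closure.
  move=> /(_ setT) []; [by exists 0 | exact: openT | ].
  move=> x [_ /(_ (Num.truncn `|f x|).+1 Logic.I)]; apply; apply: subset_closure.
  by rewrite /A /=; apply/ltW/truncnS_gt.
move: nd => /denseNE[U [[x0 /open_nbhs_nbhs/nbhs_ballP[r /= r0 xr]] U0]].
exists n, x0, r; split=> // y /xr Uy; apply: contrapT => ny.
have : (U `&` ~` closure (A n)) y by [].
by rewrite U0.
Qed.

(** Differences move the ball of the preceding lemma to the origin, and scaling
spreads it over V. *)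
Lemma sublevel_approx : exists2 C, 0 <= C & forall y e, 0 < e ->
  exists a, `|f a| <= C * `|y| /\ `|y - a| < e.
Proof.
have [n [x0 [r [r0 cl]]]] := sublevel_somewhere_dense.
have clP x e : closure (A n) x -> 0 < e -> exists2 a, `|f a| <= n%:R & `|x - a| < e.
  move=> cx e0; have [a [Aa xa]] := cx _ (nbhsx_ballx x e e0).
  by exists a => //; move: xa; rewrite -ball_normE.
have small y e : `|y| < r -> 0 < e ->
    exists a, `|f a| <= n%:R + n%:R /\ `|y - a| < e.
  move=> yr e0; have e2 : 0 < e / 2 by rewrite divr_gt0.
  have [|a fa xa] := clP (x0 + y) _ _ e2.
    by apply: cl; rewrite -ball_normE /ball_ /= opprD addrA subrr sub0r normrN.
  have [|b fb xb] := clP x0 _ _ e2; first by apply: cl; exact: ballxx.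
  exists (a - b); rewrite linearB; split.
    by rewrite (le_trans (ler_normB _ _))// lerD.
  have -> : y - (a - b) = (x0 + y - a) - (x0 - b).
    by rewrite !opprB [RHS]addrC [RHS]addrA subrKA addrA [y + b]addrC.
  by rewrite (le_lt_trans (ler_normB _ _))// [e]splitr ltrD.
exists (2 / r * (n%:R + n%:R)); first by rewrite mulr_ge0// ?divr_ge0// ?addr_ge0// ltW.
move=> y e e0; have [->|y0] := eqVneq y 0.
  by exists 0; rewrite linear0 subrr !normr0 mulr0.
have ny0 : 0 < `|y| by rewrite normr_gt0.
pose c := r / 2 / `|y|.
have c0 : 0 < c by rewrite !divr_gt0.
have [||a [fa ya]] := small (c *: y) (c * e); last 1 first.
- exists (c^-1 *: a); split.
    rewrite linearZ normrZ gtr0_norm ?invr_gt0// ler_pdivrMl//.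
    have -> : c * (2 / r * (n%:R + n%:R) * `|y|) = n%:R + n%:R.
      by rewrite /c; field; rewrite !gt_eqF.
    exact: fa.
  have -> : y - c^-1 *: a = c^-1 *: (c *: y - a).
    by rewrite scalerBr scalerA mulVf ?gt_eqF// scale1r.
  by rewrite normrZ gtr0_norm ?invr_gt0// ltr_pdivrMl.
- rewrite normrZ gtr0_norm// /c divfK ?gt_eqF// ltr_pdivrMr// ltr_pMr//.
  by rewrite ltr1n.
- by rewrite mulr_gt0.
Qed.

(** By successive approximation y is the sum of a series of a k for which f (a k)
is dominated by a geometric series.  The series of the f (a k) converges, and
its sum is f y because the graph is closed. *)
Theorem closed_graph_bounded : exists C, forall x, `|f x| <= C * `|x|.
Proof.
have [C C0 approx] := sublevel_approx.
exists (C * 2) => y.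
have [->|y0] := eqVneq y 0; first by rewrite linear0 !normr0 mulr0.
have ny0 : 0 < `|y| by rewrite normr_gt0.
have /choice[g gP] : forall p : nat * V, exists a, `|f a| <= C * `|p.2| /\
    `|p.2 - a| < `|y| * 2^-1 ^+ p.1.+1.
  by move=> [k z]; apply: approx; rewrite mulr_gt0// exprn_gt0// invr_gt0.
pose fix z k := if k is k'.+1 then z k' - g (k', z k') else y.
pose a k := g (k, z k).
have zS k : z k.+1 = z k - a k by [].
have zle k : `|z k| <= `|y| * 2^-1 ^+ k.
  case: k => [|k]; first by rewrite expr0 mulr1.
  by rewrite zS ltW//; have [] := gP (k, z k).
have fa k : `|f (a k)| <= geometric (C * `|y|) 2^-1 k.
  have [fak _] := gP (k, z k); rewrite (le_trans fak)//= -mulrA.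
  by rewrite ler_wpM2l.
have half1 : `|2^-1 : R| < 1 by rewrite gtr0_norm ?invr_gt0// invf_lt1// ltr1n.
have cn : cvgn [normed series (f \o a)].
  apply: (series_le_cvg _ _ fa (is_cvg_geometric_series half1)).
    by move=> k; exact: normr_ge0.
  by move=> k; rewrite (le_trans _ (fa k)).
have cf := normed_cvg cn.
have fz k : series (f \o a) k = f (y - z k).
  elim: k => [|k IH]; first by rewrite /series/= big_geq// subrr linear0.
  rewrite seriesSr IH zS opprB addrCA -linearD; congr (f _).
  by rewrite addrC.
have z0 : (fun k => `|y| * 2^-1 ^+ k) @ \oo --> 0.
  by rewrite -(mulr0 `|y|); apply: cvgM; [exact: cvg_cst|exact: cvg_expr].
have <- : limn (series (f \o a)) = f y.
  apply/esym/closed_graph => e e0.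
  have [k [zk fk]] : exists k, `|y| * 2^-1 ^+ k < e /\
      `|limn (series (f \o a)) - series (f \o a) k| < e.
    near \oo => k; exists k; split; near: k.
      by apply: (cvgr_lt _ z0).
    by apply: (cvgr_dist_lt _ _ cf).
  exists (y - z k); rewrite subKr -fz; split=> //.
  exact: le_lt_trans (zle k) zk.
rewrite (le_trans (lim_series_norm cn))//.
rewrite (le_trans (lim_series_le cn (is_cvg_geometric_series half1) fa))//.
rewrite (cvg_lim _ (cvg_geometric_series half1))//.
have -> : 1 - 2^-1 = 2^-1 :> R by field.
by rewrite invrK mulrAC.
Unshelve. all: by end_near. Qed.
End ClosedGraph.

(** * Complex scalars as real scalars *)

Section Realification.
Local Open Scope complex_scope.
Variables (R : realType) (X : normedModType R[i]).

Lemma RRe_norm (x : X) : (complex.Re `|x|)%:C = `|x|.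
Proof. exact/RRe_real/ger0_real. Qed.

(** The same vectors with real scalars and a real-valued norm; a name of its own
keeps the two module structures and the two norms apart. *)
Definition realification : Type := X.

HB.instance Definition _ := GRing.Zmodule.copy realification X.

Definition real_scale (a : R) (x : realification) : realification := (a%:C *: (x : X)).

Fact real_scaleA a b v : real_scale a (real_scale b v) = real_scale (a * b) v.
Proof. by rewrite /real_scale scalerA -rmorphM. Qed.
Fact real_scale1 : left_id 1 real_scale.
Proof. by move=> x; rewrite /real_scale rmorph1 scale1r. Qed.
Fact real_scaleDr : right_distributive real_scale +%R.
Proof. by move=> a x y; rewrite /real_scale scalerDr. Qed.
Fact real_scaleDl v : {morph real_scale^~ v : a b / a + b}.
Proof. by move=> a b; rewrite /real_scale rmorphD scalerDl. Qed.

HB.instance Definition _ := GRing.Zmodule_isLmodule.Build R realification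
  real_scaleA real_scale1 real_scaleDr real_scaleDl.

Definition real_norm (x : realification) : R := complex.Re `|x : X|.

Fact real_norm_ler_normD (x y : realification) : real_norm (x + y) <= real_norm x + real_norm y.
Proof. by rewrite -lecR rmorphD /= !RRe_norm ler_normD. Qed.
Lemma normc_realE (a : R) : `|a%:C| = `|a|%:C.
Proof. by rewrite normc_def /= expr0n addr0 sqrtr_sqr. Qed.
Fact real_normrZ (a : R) (x : realification) : real_norm (a *: x) = `|a| * real_norm x.
Proof. by apply: complexI; rewrite rmorphM /= !RRe_norm normrZ normc_realE. Qed.
Fact real_normr0_eq0 (x : realification) : real_norm x = 0 -> x = 0.
Proof.
move=> x0; apply: (@normr0_eq0 _ X).
by rewrite -RRe_norm -[complex.Re _]/(real_norm x) x0.
Qed.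

HB.instance Definition _ := Lmodule_isNormed.Build R realification
  real_norm_ler_normD real_normrZ real_normr0_eq0.

Lemma real_normE (x : realification) : `|x|%:C = `|x : X|.
Proof. by rewrite -RRe_norm. Qed.

End Realification.

Section RealificationComplete.
Local Open Scope complex_scope.
Variables (R : realType) (X : completeNormedModType R[i]).

Fact realification_complete (F : set_system (realification X)) :
  ProperFilter F -> cauchy F -> cvg F.
Proof.
move=> FF cF; have FF' : ProperFilter (F : set_system X) := FF.
have cG : cauchy (F : set_system X).
  apply/cauchy_ballP => e e0.
  have e0' : 0 < complex.Re e by rewrite -ltcR RRe_real// gtr0_real.
  have /cauchy_ballP/(_ _ e0') := cF.
  rewrite !near_simpl => -[[P Q] /= [FP FQ] PQ]; exists (P, Q) => //= -[x y] xy.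
  have := PQ (x, y) xy; rewrite /= -!ball_normE /=.
  by rewrite -ltcR real_normE RRe_real// gtr0_real.
have /cvg_ex[l Fl] : cvg (F : set_system X) by exact: cauchy_cvg.
apply/cvg_ex; exists l; apply/cvgrPdist_lt => e e0.
move/cvgrPdist_lt : Fl => /(_ e%:C); rewrite ltcR => /(_ e0).
by apply: filterS => x; rewrite -ltcR real_normE.
Qed.

HB.instance Definition _ :=
  Uniform_isComplete.Build (realification X) realification_complete.
End RealificationComplete.

Section RealOrComplex.
Local Open Scope complex_scope.

(** Over the complex numbers, a real form f is the real part of the complex form
that sends x to f x - i f (i x). *)
Theorem separating_form (K : numFieldType) (hK : real_or_complex K)
    (X : normedModType K) (x : X) : x != 0 ->
  exists2 h, bounded_form h & h x = 1.
Proof.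
case: hK X x => R X x0 nx0.
  have [f [lf fx fb]] := @hahn_banach R X (fun x => `|x|) (@ler_normD _ X) (@normrZ _ X) x0.
  exists (fun x => `|x0|^-1 * f x); last by rewrite fx mulVf// normr_eq0.
  split; first by move=> a x y; rewrite lf mulrDr mulrCA.
  by exists (`|x0|^-1) => x; rewrite normrM ger0_norm ?invr_ge0// ler_wpM2l ?invr_ge0.
have [f [lf fx fb]] := @hahn_banach R (realification X) (fun x => `|x|)
  (@ler_normD _ (realification X)) (@normrZ _ (realification X)) x0.
have fD x y : f (x + y) = f x + f y.
  by have := lf 1 x y; rewrite scale1r mul1r.
have f0 : f 0 = 0 by apply: (addrI (f 0)); rewrite -fD !addr0.
have fN x : f (- x) = - f x.
  by apply: (addrI (f x)); rewrite -fD !subrr f0.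
have fZ (a : R) (x : X) : f (a%:C *: x) = a * f x.
  by have := lf a x 0; rewrite !addr0 f0 addr0.
pose g (x : X) : R[i] := (f x)%:C - 'i * (f ('i *: x))%:C.
have gD x y : g (x + y) = g x + g y.
  by rewrite /g scalerDr !fD !rmorphD /= mulrDr opprD addrACA.
have ii : 'i * 'i = -1 :> R[i] by rewrite -expr2 sqr_i.
have gZ a x : g (a *: x) = a * g x.
  have gr (r : R) y : g (r%:C *: y) = r%:C * g y.
    rewrite /g; have <- : r%:C *: ('i *: y) = 'i *: (r%:C *: y) by rewrite !scalerA mulrC.
    by rewrite !fZ !rmorphM /= mulrBr [r%:C * ('i * _)]mulrCA.
  have gi y : g ('i *: y) = 'i * g y.
    rewrite /g scalerA ii scaleN1r fN rmorphN mulrN opprK.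
    by rewrite mulrBr mulrA ii mulN1r opprK addrC.
  by rewrite [a]complexE scalerDl gD gr -scalerA gi gr mulrDl mulrA.
have gx0 : g x0 != 0.
  apply/eqP => /(congr1 (@complex.Re R)) /=; rewrite !mul0r !mul1r subrr oppr0 addr0.
  by rewrite fx => /(@real_normr0_eq0 R X) /eqP; rewrite (negPf nx0).
have fbC (x : X) : `|(f x)%:C| <= `|x|.
  by rewrite normc_realE -(@real_normE R X) lecR.
have gb x : `|g x| <= 2 * `|x|.
  rewrite (le_trans (ler_normB _ _))// mulr_natl mulr2n lerD//.
  have i1 : `|'i : R[i]| = 1.
    by rewrite normc_def /= expr0n expr1n add0r sqrtr1.
  by rewrite normrM i1 mul1r (le_trans (fbC _))// normrZ i1 mul1r.
exists (fun x => (g x0)^-1 * g x); last by rewrite mulVf.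
split; first by move=> a x y; rewrite gD gZ mulrDr mulrCA.
exists (`|g x0|^-1 * 2) => x.
by rewrite normrM normfV -mulrA ler_wpM2l// invr_ge0.
Qed.

(** Closedness of the graph is expressed with norms only, so that it passes to
the realifications. *)
Theorem closed_graph_theorem (K : numFieldType) (hK : real_or_complex K)
    (X Y : completeNormedModType K) (f : X -> Y) : linear f ->
  (forall x y, (forall e, 0 < e -> exists x', `|x - x'| < e /\ `|y - f x'| < e) -> f x = y) ->
  exists C, forall x, `|f x| <= C * `|x|.
Proof.
case: hK X Y f => R X Y f lf cf.
  pose F : {linear X -> Y} := HB.pack f (GRing.isLinear.Build R X Y *:%R f lf).
  exact: (@closed_graph_bounded R X Y F).
have lf' : linear (f : realification X -> realification Y).
  by move=> a x y; exact: lf.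
pose F : {linear (realification X) -> (realification Y)} :=
  HB.pack (f : realification X -> realification Y)
    (GRing.isLinear.Build R (realification X) (realification Y) *:%R _ lf').
have [x y xy|C fC] := @closed_graph_bounded R _ _ F.
  apply: cf => e e0; have [|x' [xx' yx']] := xy (complex.Re e).
    by rewrite -ltcR RRe_real// gtr0_real.
  exists x'; move: xx' yx'.
  by rewrite -!ltcR !real_normE RRe_real// gtr0_real.
exists C%:C => x; have := fC x; rewrite -lecR rmorphM /=.
by rewrite !real_normE.
Qed.

End RealOrComplex.

(** * Bounded operators and closed subspaces *)

Section Closedness.
Variables (K : numFieldType) (X : normedModType K).

Lemma bop_bound (f : bop X) : exists2 C, 0 < C & forall x, `|f x| <= C * `|x|.
Proof.
have [_ [C fC]] := bopP f.
exists (`|C| + 1); first by rewrite ltr_wpDl.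
move=> x; rewrite (le_trans (fC x))//.
have Cx : 0 <= C * `|x| by exact: le_trans (fC x).
by rewrite -[leLHS](ger0_norm Cx) normrM normr_id mulrDl mul1r lerDl.
Qed.

Lemma closed_limit (A : set X) x : closed A ->
  (forall e, 0 < e -> exists2 a, A a & `|x - a| < e) -> A x.
Proof.
move=> cA xA; apply: cA => B /nbhs_ballP[e /= e0 eB].
have [a Aa xa] := xA _ e0; exists a; split=> //.
by apply: eB; rewrite -ball_normE.
Qed.

Lemma small_eq0 (C : K) (x : X) : 0 < C -> (forall e, 0 < e -> `|x| <= C * e) -> x = 0.
Proof.
move=> C0 xC; apply/eqP; rewrite -normr_le0.
have [->//|x0] := eqVneq x 0; first by rewrite normr0.
have nx : 0 < `|x| by rewrite normr_gt0.
have := xC (`|x| / (C * 2)); rewrite divr_gt0 ?mulr_gt0// => /(_ isT).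
have -> : C * (`|x| / (C * 2)) = `|x| / 2 by field; rewrite gt_eqF.
by rewrite ler_pdivlMr// mulr_natr mulr2n gerDl.
Qed.

Lemma closed_kernel (f : bop X) : closed (kernel f).
Proof.
move=> x /= clx; have [C C0 fC] := bop_bound f.
apply: (small_eq0 C0) => e e0.
have [a [fa xa]] := clx _ (nbhsx_ballx x e e0).
have -> : f x = f (x - a) by rewrite linearB /= (fa : f a = 0) subr0.
rewrite (le_trans (fC _))// ler_wpM2l ?(ltW C0)//.
by move: xa; rewrite -ball_normE => /= /ltW.
Qed.

Lemma kernel_subspace (f : bop X) : subspace_set (kernel f).
Proof.
split; first exact: linear0.
by move=> a x y fx fy; rewrite /kernel /= linearP /= [f x]fx [f y]fy scaler0 addr0.
Qed.

Definition kernel_cs (f : bop X) : closed_subspace X :=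
  ClosedSubspace (kernel_subspace f) (@closed_kernel f).

Lemma restr_exp (T : bop X) (M : closed_subspace X) (TM : Defs.invariant T M) n x :
  cs_val ((restr TM ^+ n) x) = (T ^+ n) (cs_val x).
Proof. by elim: n => [//|n IH]; rewrite !exprS !bopM -IH. Qed.

End Closedness.

(** * From left Drazin invertibility to the decomposition *)

Section Forward.
Variables (K : numFieldType) (hK : real_or_complex K) (X : completeNormedModType K).

Let Jfin := finite_rank_regular_dcc_ideal (@separating_form K hK X).

Lemma left_semi_B_Fredholm_splitting (T : bop X) : left_semi_B_Fredholm T ->
  exists (E B : bop X) k, [/\ E * E = E, E * T = T * E, T ^+ k * E = 0 &
    B * T - (1 - E) \in @finite_rank K X].
Proof.
move=> [p []]; elim/C0W: p => f ff [fT [b _]]; elim/C0W: b => B Bf [n nf].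
have ffJ : f * f - f \in @finite_rank K X by apply/C0P; rewrite rmorphM.
have [P [PP Pf]] := idempotent_lift Jfin ffJ.
have piP : C0_pi P = C0_pi f by apply/C0P.
rewrite -piP in fT Bf nf.
apply: (kato_type_splitting Jfin PP (b := B) (r := n)).
- by apply/C0P; rewrite !rmorphM.
- by apply/C0P; rewrite rmorphD !rmorphM /= -mulrDr.
- by rewrite -[(T * P) ^+ n]subr0; apply/C0P; rewrite rmorphXn rmorphM rmorph0.
Qed.

(** M = N(1 - E) and N = N(E).  The element a is T on N and the identity on M; it
is left invertible modulo J, so a = a s a.  Then (1 - E) a s restricts to a
projection of N onto the range of T, which is closed as the kernel of the
complementary projection; and 1 - s a, which is in J, is the identity on
N(a). *)
Lemma splitting_nilpotent_left_semi_Fredholm (T E B : bop X) k :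
    E * E = E -> E * T = T * E -> T ^+ k * E = 0 ->
    B * T - (1 - E) \in @finite_rank K X ->
  nilpotent_left_semi_Fredholm T.
Proof.
move=> EE ET TE BT.
have nE : (1 - E) * (1 - E) = 1 - E by rewrite mulrBr mulr1 mulrBl mul1r EE subrr subr0.
have En : E * (1 - E) = 0 by rewrite mulrBr mulr1 EE subrr.
have ETn : E * T * (1 - E) = 0 by rewrite ET -mulrA En mulr0.
have ME x : kernel (1 - E) x <-> E x = x.
  rewrite -[kernel _ _]/(x - E x = 0); split=> [/subr0_eq //|->]; exact: subrr.
have TM : Defs.invariant T (kernel_cs (1 - E)).
  by move=> _ [x /ME Ex <-]; apply/ME; rewrite -bopM ET bopM Ex.
have TN : Defs.invariant T (kernel_cs E).
  by move=> _ [x Ex <-]; rewrite /kernel_cs /kernel /= -bopM ET bopM [E x]Ex linear0.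
exists (kernel_cs (1 - E)), (kernel_cs E), TM, TN; split.
- split.
    apply/seteqP; split=> [x [/ME Ex E0]|_ ->]; first by rewrite -Ex.
    by split; [apply/ME|]; exact: linear0.
  move=> x; exists (E x); first by apply/ME; rewrite -bopM EE.
  exists (x - E x); last by rewrite addrC subrK.
  by rewrite /kernel_cs /kernel /= linearB /= -bopM EE subrr.
- exists k; apply: bop_ext => x; apply: val_inj; rewrite /= restr_exp.
  have /ME Ex := set_mem (cs_valP x).
  by rewrite -Ex -bopM TE.
have [a aE] : exists u, u = T * (1 - E) + E by eexists.
have ba : (B * (1 - E) + E) * a - 1 \in @finite_rank K X.
  rewrite aE; exact: (corner_left_invertible Jfin EE ETn BT).
have [s asa Jr] := inner_inverse Jfin ba.
have an : a * (1 - E) = T * (1 - E) by rewrite aE mulrDl -mulrA nE En addr0.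
have nT : (1 - E) * T = T * (1 - E) by rewrite mulrBl mulrBr mul1r mulr1 ET.
have na : (1 - E) * a = a * (1 - E).
  rewrite an aE mulrDr mulrA nT -mulrA nE.
  by rewrite [(1 - E) * E]mulrBl mul1r EE subrr addr0.
have [P0 P0E] : exists u, u = (1 - E) * a * s by eexists.
have P0N x : E (P0 x) = 0 by rewrite -bopM P0E !mulrA En !mul0r.
have PN : Defs.invariant P0 (kernel_cs E) by move=> _ [x _ <-]; exact: P0N.
have P0P0 : P0 * P0 = P0.
  have -> : P0 * P0 = (1 - E) * (a * s * a) * (1 - E) * s.
    by rewrite P0E {2}na !mulrA.
  by rewrite -asa -(mulrA (1 - E)) -na mulrA nE P0E.
have P0a x : P0 (a x) = (1 - E) (a x).
  by rewrite -!bopM P0E -!mulrA (mulrA a) -asa.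
have aN x : E x = 0 -> a x = T x.
  by move=> Ex; rewrite aE bopD bopM Ex addr0 bopD bopN bop1 Ex subr0.
have rPN : range (restr PN) = range (restr TN).
  apply/seteqP; split=> _ [x _ <-].
    have yN : kernel E ((1 - E) (s (cs_val x))).
      exact: (congr1 (fun u : bop X => u (s (cs_val x))) En).
    exists (CsType (mem_set yN : _ \in cs_pred (kernel_cs E))) => //.
    by apply: val_inj; rewrite /= P0E na an !bopM.
  exists (restr TN x) => //; apply: val_inj; rewrite /=.
  have Ex : E (cs_val x) = 0 := set_mem (cs_valP x).
  rewrite -aN// P0a bopD bopN bop1 aN//.
  by rewrite -[E (T _)]bopM ET bopM Ex linear0 subr0.
have PNPN : restr PN * restr PN = restr PN.
  by apply: bop_ext => x; apply: val_inj; rewrite /= -bopM P0P0.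
split.
- rewrite -rPN.
  have -> : range (restr PN) = kernel (1 - restr PN).
    apply/seteqP; split=> [_ [x _ <-]|x].
      by rewrite -[kernel _ _]/(restr PN x - (restr PN * restr PN) x = 0) PNPN subrr.
    rewrite -[kernel _ _]/(x - restr PN x = 0) => /subr0_eq xP.
    by exists x.
  exact: closed_kernel.
- pose r := 1 - s * a.
  have /asboolP[n [v rv]] : (1 - E) * r \in @finite_rank K X by exact: finite_rankMl.
  have vN i : kernel E (v i).
    have : range ((1 - E) * r) (v i).
      rewrite rv; exists (fun j => (j == i)%:R); rewrite (bigD1 i)//= eqxx scale1r.
      by rewrite big1 ?addr0// => j /negPf ->; rewrite scale0r.
    move=> [x _ <-]; have Er0 : E * ((1 - E) * r) = 0 by rewrite mulrA En mul0r.
    exact: (congr1 (fun u : bop X => u x) Er0).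
  apply: (@finite_dimS _ _ _ _ (fun i => CsType (mem_set (vN i) : _ \in cs_pred (kernel_cs E)))).
    exact: kernel_subspace.
  move=> x Tx; have Ex : E (cs_val x) = 0 := set_mem (cs_valP x).
  have ax : a (cs_val x) = 0.
    by rewrite aN//; exact: (congr1 (@cs_val _ _ _) Tx).
  have rx : r (cs_val x) = cs_val x by rewrite /r bopD bopN bop1 bopM ax linear0 subr0.
  have : range ((1 - E) * r) (cs_val x).
    by exists (cs_val x) => //; rewrite bopM rx bopD bopN bop1 Ex subr0.
  rewrite rv => -[c xc]; exists c; apply: val_inj; rewrite raddf_sum /= xc.
  by apply: eq_bigr => i _.
- by exists (restr PN).
Qed.
End Forward.

(** * From the decomposition to left Drazin invertibility *)

Section Backward.
Variables (K : numFieldType) (hK : real_or_complex K) (X : completeNormedModType K).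

Lemma bop_of_closed_graph (f : X -> X) : linear f ->
  (forall x y, (forall e, 0 < e -> exists x', `|x - x'| < e /\ `|y - f x'| < e) -> f x = y) ->
  exists F : bop X, forall x, F x = f x.
Proof.
move=> lf /(closed_graph_theorem hK lf) fb.
have fB : f \in @bounded_op K X by apply/asboolP.
by exists (Bop fB).
Qed.

(** The graph of the projection is closed since M and N are. *)
Lemma bounded_projection (M N : closed_subspace X) : direct_sum M N ->
  exists E : bop X, forall x, cs_set M (E x) /\ cs_set N (x - E x).
Proof.
move=> [MN0 MN].
have /choice[e eP] : forall x, exists m, cs_set M m /\ cs_set N (x - m).
  by move=> x; have [m Mm [n Nn ->]] := MN x; exists m; split=> //; rewrite addrAC subrr add0r.
have eU x m : cs_set M m -> cs_set N (x - m) -> e x = m.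
  move=> Mm Nxm; have [Mex Nex] := eP x; apply/eqP; rewrite -subr_eq0; apply/eqP.
  have : (M `&` N) (e x - m).
    split.
      by have := proj2 (cs_subspace M) (-1) _ _ Mm Mex; rewrite scaleN1r addrC.
    have := proj2 (cs_subspace N) (-1) _ _ Nex Nxm.
    by rewrite scaleN1r opprB subrKA.
  by rewrite MN0.
have le : linear e.
  move=> a x y; have [Mx Nx] := eP x; have [My Ny] := eP y; apply: eU.
    exact: (proj2 (cs_subspace M)).
  have := proj2 (cs_subspace N) a _ _ Nx Ny.
  by rewrite scalerBr addrACA opprD.
have [x y xy|E EE] := bop_of_closed_graph le; last first.
  by exists E => x; rewrite EE.
apply: eU.
  apply: (closed_limit (@cs_closed _ _ M)) => eps eps0.
  have [x' [_ yx']] := xy _ eps0; exists (e x') => //; exact: (proj1 (eP x')).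
apply: (closed_limit (@cs_closed _ _ N)) => eps eps0.
have [|x' [xx' yx']] := xy (eps / 2); first by rewrite divr_gt0.
exists (x' - e x'); first exact: (proj2 (eP x')).
have -> : x - y - (x' - e x') = (x - x') - (y - e x').
  by rewrite !opprB [LHS]addrACA [RHS]addrACA [- y - x']addrC.
by rewrite (le_lt_trans (ler_normB _ _))// [eps]splitr ltrD.
Qed.

Variables (T E : bop X) (N : closed_subspace X) (TN : Defs.invariant T N).
Hypothesis (EN : forall x, cs_set N x <-> E x = 0).
Hypothesis EE : E * E = E.

(** U composed with the projection 1 - E onto N, as an operator of X. *)
Lemma cs_extend (U : bop (cs_type N)) :
  exists F : bop X, forall y x, x - E x = cs_val y -> F x = cs_val (U y).
Proof.
have nN x : cs_set N (x - E x).
  by apply/EN; rewrite linearB /= -bopM EE subrr.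
pose q x : cs_type N := CsType (mem_set (nN x) : _ \in cs_pred N).
pose f x := cs_val (U (q x)).
have qD a x y : q (a *: x + y) = a *: q x + q y.
  by apply: val_inj; rewrite /= linearP /= opprD addrACA -scalerBr.
have [C C0 UC] := bop_bound U; have [D D0 qE] := bop_bound (1 - E).
have fB : f \in @bounded_op K X.
  apply/asboolP; split; first by move=> a x y; rewrite /f qD linearP.
  exists (C * D) => x; rewrite (le_trans (UC _))// -mulrA ler_wpM2l ?(ltW C0)//.
  exact: qE.
exists (Bop fB) => y x xy; rewrite /= /f; congr (cs_val (U _)).
exact: val_inj.
Qed.

(** H projects onto the kernel of T on N, and Q projects X onto the range of T
on N.  L x is the only c in N and N(H) with T c = Q x; these conditions are
closed, so L is bounded. *)
Lemma left_inverse_of_left_semi_Fredholm : left_semi_Fredholm (restr TN) ->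
  exists L H : bop X, [/\ H \in @finite_rank K X, E * L = 0 &
    L * T * (1 - E) = (1 - H) * (1 - E)].
Proof.
move=> [_ [n [v kv]] [P [PP rP]]].
have [h [hb hv]] := dual_coordinates (@separating_form K hK X) (fun i => cs_val (v i)).
have [H HE] := finite_sum_op (fun i => cs_val (v i)) hb.
have Hspan x : lin_span (fun i => cs_val (v i)) (H x) by rewrite HE; eexists.
have HF : H \in @finite_rank K X.
  by apply: (finite_rankS (v := fun i => cs_val (v i))) => _ [x _ <-].
have kerP x : cs_set N x -> T x = 0 -> H x = x.
  move=> Nx Tx; pose y : cs_type N := CsType (mem_set Nx : _ \in cs_pred N).
  rewrite HE -hv//.
  have : kernel (restr TN) y by apply: val_inj.
  by rewrite kv => -[c yc]; exists c; rewrite -[x]/(\val y) yc raddf_sum.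
have kerv i : restr TN (v i) = 0.
  have : kernel (restr TN) (v i).
    rewrite kv; exists (fun j => (j == i)%:R); rewrite (bigD1 i)//= eqxx scale1r.
    by rewrite big1 ?addr0// => j /negPf ->; rewrite scale0r.
  by [].
have TH x : T (H x) = 0.
  rewrite HE linear_sum big1// => i _; rewrite linearZ /=.
  by have /(congr1 (@cs_val _ _ _)) /= -> := kerv i; rewrite scaler0.
have EH x : E (H x) = 0.
  rewrite HE linear_sum big1// => i _; rewrite linearZ /=.
  by rewrite (proj1 (EN _) (set_mem (cs_valP (v i)))) scaler0.
have [Q QP] := cs_extend P.
have Prestr y : P (restr TN y) = restr TN y.
  have : range P (restr TN y) by rewrite rP; exists y.
  by move=> [z _ <-]; rewrite -bopM PP.
have nN x : cs_set N (x - E x).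
  by apply/EN; rewrite linearB /= -bopM EE subrr.
have /choice[l lP] : forall x, exists c, [/\ E c = 0, H c = 0 & T c = Q x].
  move=> x; pose y : cs_type N := CsType (mem_set (nN x) : _ \in cs_pred N).
  have : range (restr TN) (P y) by rewrite -rP; exists y.
  move=> [z _ /(congr1 (@cs_val _ _ _)) /= Tz].
  have Ez : E (cs_val z) = 0 := proj1 (EN _) (set_mem (cs_valP z)).
  exists (cs_val z - H (cs_val z)); rewrite !linearB /= TH EH Ez !subr0; split=> //.
    by rewrite (kerP (H _)) ?subrr//; apply/EN.
  by rewrite Tz (QP y).
have lU x c : E c = 0 -> H c = 0 -> T c = Q x -> l x = c.
  move=> Ec Hc Tc; have [El Hl Tl] := lP x.
  apply/eqP; rewrite -subr_eq0 -(kerP (l x - c)); first by rewrite linearB /= Hl Hc subrr.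
    by apply/EN; rewrite linearB /= El Ec subrr.
  by rewrite linearB /= Tl Tc subrr.
have ll : linear l.
  move=> a x y; have [Ex Hx Tx] := lP x; have [Ey Hy Ty] := lP y.
  by apply: lU; rewrite !linearP /= ?Ex ?Ey ?Hx ?Hy ?Tx ?Ty ?scaler0 ?addr0.
have [x y xy|L LE] := bop_of_closed_graph ll.
  apply: lU.
  - apply: (closed_limit (@closed_kernel _ _ E)) => e e0.
    by have [x' [_ yx']] := xy e e0; exists (l x') => //; have [] := lP x'.
  - apply: (closed_limit (@closed_kernel _ _ H)) => e e0.
    by have [x' [_ yx']] := xy e e0; exists (l x') => //; have [] := lP x'.
  have [C C0 TC] := bop_bound T; have [D D0 QD] := bop_bound Q.
  apply/eqP; rewrite -subr_eq0; apply/eqP.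
  apply: (@small_eq0 _ _ (C + D)) => [|e e0]; first exact: addr_gt0.
  have [x' [xx' yx']] := xy e e0; have [_ _ Tl] := lP x'.
  have -> : T y - Q x = T (y - l x') - Q (x - x').
    by rewrite (linearB T) (linearB Q) /= Tl opprB addrA subrK.
  rewrite (le_trans (ler_normB _ _))// mulrDl lerD//.
    by rewrite (le_trans (TC _))// ler_wpM2l ?(ltW C0)// ltW.
  by rewrite (le_trans (QD _))// ler_wpM2l ?(ltW D0)// ltW.
exists L, H; split=> //.
  by apply: bop_ext => x; rewrite bopM LE; have [] := lP x.
apply: bop_ext => x; rewrite !bopM LE; set z := (1 - E) x.
have Nz : cs_set N z by exact: nN.
have Ez : E z = 0 by apply/EN.
pose y : cs_type N := CsType (mem_set Nz : _ \in cs_pred N).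
apply: lU; rewrite ?bopD ?bopN ?bop1 linearB /= ?Ez ?EH ?TH ?subr0//.
  by rewrite (kerP (H z)) ?subrr//; apply/EN.
have ETz : E (T z) = 0 by apply/EN; exact: (set_mem (cs_valP (restr TN y))).
by rewrite (QP (restr TN y)) ?Prestr//= ETz subr0.
Qed.

End Backward.

Lemma unipotent_left_inverse (A : pzRingType) (x : A) n : x ^+ n = 0 ->
  exists u, u * (1 + x) = 1.
Proof.
move=> xn0; suff [u uE] : exists u, u * (1 + x) = 1 - (- x) ^+ n.
  by exists u; rewrite uE exprNn xn0 mulr0 subr0.
elim: n {xn0} => [|n [u uE]]; first by exists 0; rewrite mul0r subrr.
exists (u + (- x) ^+ n); rewrite mulrDl uE mulrDr mulr1 exprSr mulrN opprK addrA subrK //.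
Qed.

Section Converse.
Variables (K : numFieldType) (hK : real_or_complex K) (X : completeNormedModType K).

(** The left inverse of T + E modulo J is the inverse of 1 + T E on M and L on
N. *)
Lemma nilpotent_left_semi_Fredholm_left_Drazin (T : bop X) :
  nilpotent_left_semi_Fredholm T -> left_semi_B_Fredholm T.
Proof.
move=> [M [N [TM [TN [MN [n Tn] fT]]]]].
have [E EP] := bounded_projection hK MN; have [MN0 _] := MN.
have disj x : cs_set M x -> cs_set N x -> x = 0.
  by move=> Mx Nx; have : (M `&` N) x by []; rewrite MN0.
have ME x : cs_set M x -> E x = x.
  move=> Mx; apply/esym/subr0_eq; apply: disj; last exact: (proj2 (EP x)).
  have := proj2 (cs_subspace M) (-1) _ _ (proj1 (EP x)) Mx.
  by rewrite scaleN1r addrC.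
have EN x : cs_set N x <-> E x = 0.
  split=> [Nx|Ex]; last by have [_] := EP x; rewrite Ex subr0.
  apply: disj; first exact: (proj1 (EP x)).
  have := proj2 (cs_subspace N) (-1) _ _ (proj2 (EP x)) Nx.
  by rewrite scaleN1r opprB subrK.
have EE : E * E = E by apply: bop_ext => x; rewrite bopM ME//; exact: (proj1 (EP x)).
have ET : E * T = T * E.
  apply: bop_ext => x; rewrite !bopM.
  have -> : T x = T (E x) + T (x - E x) by rewrite -linearD addrC subrK.
  rewrite linearD /= ME; last exact: (TM _ (imageP T (proj1 (EP x)))).
  by rewrite (proj1 (EN (T (x - E x)))) ?addr0//; exact: (TN _ (imageP T (proj2 (EP x)))).
have TnE : T ^+ n * E = 0.
  apply: bop_ext => x; rewrite bopM.
  pose y : cs_type M := CsType (mem_set (proj1 (EP x)) : _ \in cs_pred M).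
  by rewrite -[E x]/(cs_val y) -(restr_exp TM) Tn.
have TEn : (T * E) ^+ n.+1 = 0.
  by rewrite exprMn_comm// (idem_expS _ EE) exprS -mulrA TnE mulr0.
have [u uE] := unipotent_left_inverse TEn.
have [L [H [HF EL LT]]] := left_inverse_of_left_semi_Fredholm hK EN EE fT.
have nE : (1 - E) * E = 0 by rewrite mulrBl mul1r EE subrr.
have nn : (1 - E) * (1 - E) = 1 - E by rewrite [LHS]mulrBr mulr1 nE subr0.
have [B BE] : exists B, B = E * u * E + L * (1 - E) by eexists.
have BT : B * (T + E) = 1 - H * (1 - E).
  have -> : B * (T + E) = E * (u * (1 + T * E)) * E + L * T * (1 - E).
    rewrite BE mulrDl; congr (_ + _).
      rewrite -!mulrA; congr (_ * (_ * _)).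
      by rewrite mulrDr EE ET mulrDl mul1r -mulrA EE addrC.
    rewrite -!mulrA; congr (_ * _).
    by rewrite mulrDr nE addr0 mulrBl mul1r mulrBr mulr1 ET.
  by rewrite uE mulr1 EE LT mulrBl mul1r addrA [E + _]addrC subrK.
have BEC : B * E = E * B.
  rewrite BE mulrDl [RHS]mulrDr -(mulrA _ E E) EE -(mulrA L) nE mulr0 addr0.
  by rewrite !mulrA EE EL mul0r addr0.
exists (C0_pi E); split.
- by rewrite /Defs.idempotent -rmorphM EE.
- split; first by rewrite -!rmorphM ET.
  exists (C0_pi B).
    by rewrite /Defs.comm /= -!rmorphM BEC.
  rewrite -rmorphD -rmorphM BT; apply/C0P.
  by rewrite addrAC subrr sub0r rpredN; exact: finite_rankMr.
- by exists n.+1; rewrite -rmorphM -rmorphXn TEn rmorph0.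
Qed.

End Converse.

Theorem theorem3p6 (K : numFieldType) (hK : real_or_complex K)
    (X : completeNormedModType K) (T : bop X) :
  left_semi_B_Fredholm T <-> nilpotent_left_semi_Fredholm T.
Proof.
split; last exact: nilpotent_left_semi_Fredholm_left_Drazin.
move=> /(left_semi_B_Fredholm_splitting hK)[E [B [k [EE ET TE BT]]]].
exact: (splitting_nilpotent_left_semi_Fredholm hK EE ET TE BT).
Qed.
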